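(* Let the matrix $A\in\mathbb{Z}^{m\times n}$ have $\mathrm{rk}(A)=m$ and encoding length $L$. The Maximum Support Image Algorithm finds a maximum support solution to $A^\top y\ge0$ in $O\left(m^2n^2\cdot L\right)$ arithmetic operations. Using the Smoothed Perceptron method or the Mirror Prox method instead of the von Neumann algorithm requires $O\left(m^3n\sqrt{\log n}\cdot L\right)$ arithmetic operations.
   Context: Notation: $[n]=\{1,\dots,n\}$; $a_1,\dots,a_n$ are the columns of $A$; $A_B$ is the submatrix of columns indexed by $B$; $\hat v=v/\|v\|_2$ for $v\ne0$, and by convention $\hat 0=0$; $\vec e_k$ is the $k$th unit vector; $I_m$ is the $m\times m$ identity matrix; for symmetric positive definite $Q$, $\langle v,w\rangle_Q=v^\top Qw$, $\|v\|_Q=\sqrt{\langle v,v\rangle_Q}$; $a^\perp$ is the orthogonal complement of $a$. The encoding length $L$ is the total number of bits needed to write the entries of $A$ in binary. A maximum support solution to $A^\top y\ge0$ is a solution $y$ satisfying the maximum number of strict inequalities, i.e. such that the support of $A^\top y$ is the inclusion-wise maximal one. Further $$\Delta_A=\max\Big\{\prod_{j\in B}\|a_j\|_2: B\subseteq[n],\ |B|=\mathrm{rk}(A_B)\Big\},\qquad \theta_A=\frac1{m^2\Delta_A^2}.$$ Von Neumann algorithm, $\mathrm{VonNeumann}(A,Q,\varepsilon)$: start with $x:=\vec e_1$ and $y:=a_1/\|a_1\|_Q$, where $a_1$ is the first column of the matrix passed to the algorithm. While $\|y\|_Q>\varepsilon$: if $\langle a_i,y\rangle_Q>0$ for all columns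 $a_i$, return $(x,y)$ and stop; otherwise select $k$ with $\langle a_k,y\rangle_Q\le0$, let $\lambda:=\frac{\langle y-a_k/\|a_k\|_Q,\,y\rangle_Q}{\|y-a_k/\|a_k\|_Q\|_Q^2}$ and update $x:=(1-\lambda)x+\lambda\vec e_k$, $y:=(1-\lambda)y+\lambda a_k/\|a_k\|_Q$. When the loop ends return $(x,y)$. The Smoothed Perceptron (Peña and Soheili) and Mirror Prox (Yu, Kılınç-Karzan and Carbonell) methods may replace it; they have the known guarantee that on a matrix with $n$ columns in $\mathbb{R}^m$ they terminate in $O(\sqrt{\log n}/\varepsilon)$ iterations of $O(mn)$ arithmetic operations each, and output $x\ge0$, $\|x\|_1=1$, $y=\sum_ix_ia_i/\|a_i\|_Q$ with either $A^\top Qy>0$ or $\|y\|_Q\le\varepsilon$. Maximum Support Image Algorithm, with $\varepsilon=\frac1{11m}$. Input: $A$ with $\mathrm{rk}(A)=m$. 1. Compute $\theta:=\theta_A$ (for the input matrix). Set $Q:=I_m$, $R:=I_m$, $U:=I_m$, $T:=[n]$ (the index set of columns of the current $A$), $r:=m$. 2. While $T\neq\emptyset$: - set $(x,y):=\mathrm{VonNeumann}(A,Q,\varepsilon)$; - if $A^\top Qy>0$, return $\bar y=UQy$ and terminate; otherwise rescale $R:=\frac1{1+\varepsilon}\Big(R+\sum_{i\in T}\frac{x_i}{\|a_i\|_Q^2}a_ia_i^\top\Big)$, $Q:=R^{-1}$ (the right-hand side of the update of $R$ uses the old $Q$); - while there exists $k\in T$ with $\|\hat a_k\|_Q<\theta$,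 perform Remove$(k)$: select $W\in\mathbb{R}^{r\times(r-1)}$ whose columns form an orthonormal basis of $a_k^\perp$; set $A:=W^\top A$, delete all zero columns and remove the corresponding indices from $T$; set $R:=W^\top RW$, $U:=UW$, $r:=r-1$, and recompute $Q:=R^{-1}$. 3. If the loop ends with $T=\emptyset$, return $\bar y=0$.
   Formalization: Zero columns of A, for which the normalisation and Remove are undefined, are dropped from T at the start (T = [n] if there are none); log n is read as log max(n,2), since for n = 1 the stated bound would be 0; m ≥ 1 is assumed. *)

(* Defs.v *)
From HB Require Import structures.
From mathcomp Require Import all_boot all_order all_algebra.
From mathcomp Require Import reals exp.

Set Implicit Arguments.
Unset Strict Implicit.
Unset Printing Implicit Defensive.

Import Order.TTheory GRing.Theory Num.Theory.
Local Open Scope ring_scope.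

(** * Real-number programs and their operation count *)

Inductive aop := Add | Sub | Mul | Div.

(** Programs over a type [num] of numbers.  Control flow and index manipulations
    are ordinary Rocq terms.  [Choose P] returns an unspecified value satisfying
    [P]; [Iter body s] repeats [body], from [s], until it returns [inr _]. *)
Inductive prog (num : Type) : Type -> Type :=
| Ret B : B -> prog num B
| Bind B C : prog num B -> (B -> prog num C) -> prog num C
| Arith : aop -> num -> num -> prog num num
| Sqrt : num -> prog num num
| Less : num -> num -> prog num bool
| Choose B : (B -> Prop) -> prog num B
| Iter X B : (X -> prog num (X + B)) -> X -> prog num B.

Arguments Ret {num B}.
Arguments Arith {num}.
Arguments Sqrt {num}.
Arguments Less {num}.
Arguments Choose {num B}.
Arguments Iter {num X B}.

Notation "'let!' x := p 'in' q" := (Bind p (fun x => q))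
  (at level 200, x pattern, p at level 200, q at level 200,
   format "'[v' 'let!'  x  :=  p  'in' '/' q ']'").

Definition aop_eval (F : fieldType) (o : aop) : F -> F -> F :=
  match o with
  | Add => fun x y => x + y
  | Sub => fun x y => x - y
  | Mul => fun x y => x * y
  | Div => fun x y => x / y
  end.

(** [wp p post t]: started with operation counter [t], every execution of [p]
    (for every resolution of the choices) terminates without getting stuck, and
    its result [v] and final counter [t'] satisfy [post v t'].  Arithmetic
    operations, square roots and comparisons cost 1; dividing by [0], taking the
    square root of a negative number and choosing from the empty set are errors.
    Loops are interpreted by the least fixed point, so that divergence satisfies
    no postcondition. *)
Fixpoint wp (R : realType) (B : Type) (p : prog R B) :
    (B -> nat -> Prop) -> nat -> Prop :=
  match p in prog _ B return (B -> nat -> Prop) -> nat -> Prop with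
  | Ret _ v => fun post t => post v t
  | Bind _ _ p f => fun post t => wp p (fun v t' => wp (f v) post t') t
  | Arith o x y => fun post t =>
      (if o is Div then y != 0 else true) /\ post (aop_eval o x y) t.+1
  | Sqrt x => fun post t => 0 <= x /\ post (Num.sqrt x) t.+1
  | Less x y => fun post t => post (x < y) t.+1
  | Choose _ P => fun post t =>
      (exists v, P v) /\ (forall v, P v -> post v t)
  | Iter X _ body s0 => fun post t0 =>
      forall I : X -> nat -> Prop,
        (forall s t,
           wp (body s) (fun v t' => match v with
                                    | inl s' => I s' t'
                                    | inr b => post b t'
                                    end) t ->
           I s t) ->
        I s0 t0
  end.

(** * The Maximum Support Image Algorithm *)

(** The code is written over an abstract type [num] of numbers with constants
    [cst], so that numbers can only be computed by counted operations. *)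
Section Programs.
Variables (num : Type) (cst : nat -> num).
Local Notation prog := (prog num).
Local Notation zero := (cst 0%N).
Local Notation one := (cst 1%N).

Definition add := Arith (num := num) Add.
Definition sub := Arith (num := num) Sub.
Definition mul := Arith (num := num) Mul.
Definition div := Arith (num := num) Div.

Fixpoint foldM (I X : Type) (f : X -> I -> prog X) (s : seq I) (z : X) :
    prog X :=
  if s is i :: s' then let! z' := f z i in foldM f s' z' else Ret z.

(** The function equal to [f] on [s] and to [d] elsewhere. *)
Fixpoint tabulate (I : eqType) (B : Type) (d : B) (f : I -> prog B)
    (s : seq I) : prog (I -> B) :=
  if s is i :: s' then
    let! v := f i in
    let! g := tabulate d f s' in
    Ret (fun j => if j == i then v else g j)
  else Ret (fun _ => d).

Definition sumM (I : Type) (s : seq I) (f : I -> prog num) : prog num :=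
  foldM (fun z i => let! v := f i in add z v) s zero.

Definition build_mx p q (f : 'I_p -> 'I_q -> prog num) : prog 'M[num]_(p, q) :=
  let! g := tabulate zero (fun ij => f ij.1 ij.2) (enum {: 'I_p * 'I_q}) in
  Ret (\matrix_(i, j) g (i, j)).

Definition mulM p q s (A : 'M[num]_(p, q)) (B : 'M[num]_(q, s)) :
    prog 'M[num]_(p, s) :=
  build_mx (fun i j => sumM (enum 'I_q) (fun k => mul (A i k) (B k j))).

Definition dotM p (u v : 'cV[num]_p) : prog num :=
  sumM (enum 'I_p) (fun i => mul (u i ord0) (v i ord0)).

Definition id_mx p : 'M[num]_p := \matrix_(i, j) if i == j then one else zero.

Definition zero_mx p q : 'M[num]_(p, q) := \matrix_(i, j) zero.

(** The elements of [T] whose column in [A] is nonzero. *)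
Definition nonzero_cols p q (A : 'M[num]_(p, q)) (T : {set 'I_q}) :
    prog {set 'I_q} :=
  let! b := tabulate false
    (fun j => let! s := dotM (col j A) (col j A) in Less zero s) (enum T) in
  Ret [set j in T | b j].

(** Principal pivot transform: if [w = M v], the resulting matrix expresses [w]
    with [w_k] replaced by [v_k] as a function of [v] with [v_k] replaced by
    [w_k].  Pivoting on every [k] inverts a positive definite matrix. *)
Definition pivot p (M : 'M[num]_p) (k : 'I_p) : prog 'M[num]_p :=
  build_mx (fun i j =>
    if i == k then
      if j == k then div one (M k k)
      else let! u := div (M k j) (M k k) in sub zero u
    else
      let! u := div (M i k) (M k k) in
      if j == k then Ret u
      else let! v := mul u (M k j) in sub (M i j) v).

Definition inverse p (M : 'M[num]_p) : prog 'M[num]_p :=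
  foldM (@pivot p) (enum 'I_p) M.

(** The columns with positive index of the Householder reflection that maps [a]
    to a multiple of the first unit vector; they form an orthonormal basis of the
    orthogonal complement of [a]. *)
Definition householder p : 'cV[num]_p -> prog 'M[num]_(p, p.-1) :=
  match p return 'cV[num]_p -> prog 'M[num]_(p, p.-1) with
  | O => fun _ => Ret (zero_mx O O)
  | p'.+1 => fun a =>
      let! s := dotM a a in
      let! na := Sqrt s in
      let! neg := Less (a ord0 ord0) zero in
      let! v0 := (if neg then sub (a ord0 ord0) na else add (a ord0 ord0) na) in
      let v : 'cV[num]_p'.+1 :=
        \col_i if i == ord0 then v0 else a i ord0 in
      let! d := dotM v v in
      build_mx (fun (i : 'I_p'.+1) (j : 'I_p') =>
        let! u := mul (v i ord0) (v (lift ord0 j) ord0) in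
        let! u2 := add u u in
        let! w := div u2 d in
        sub (if i == lift ord0 j then one else zero) w)
  end.

(** One greedy step towards a column basis with the largest product of norms:
    [D] holds the columns projected orthogonally to the chosen ones, [sq] the
    squared norms of the original columns and [d] the product of those of the
    chosen ones. *)
Definition greedy_step p q (sq : 'I_q -> num) (z : 'M[num]_(p, q) * num) :
    prog ('M[num]_(p, q) * num) :=
  let: (D, d) := z in
  let! rr := tabulate zero (fun j => dotM (col j D) (col j D)) (enum 'I_q) in
  let! nz := tabulate false (fun j => Less zero (rr j)) (enum 'I_q) in
  let! best := foldM (fun (best : option 'I_q) j =>
      if ~~ nz j then Ret best
      else if best is Some b then
        let! lt := Less (sq b) (sq j) in Ret (if lt then Some j else Some b)
      else Ret (Some j)) (enum 'I_q) None in
  if best is Some k then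
    let! d' := mul d (sq k) in
    let! c := tabulate zero (fun j =>
      let! u := dotM (col k D) (col j D) in div u (rr k)) (enum 'I_q) in
    let! D' := build_mx (fun i j =>
      let! u := mul (c j) (D i k) in sub (D i j) u) in
    Ret (D', d')
  else Ret (D, d).

Definition compute_theta p q (A : 'M[num]_(p, q)) : prog num :=
  let! sq := tabulate zero (fun j => dotM (col j A) (col j A)) (enum 'I_q) in
  let! z := foldM (fun z (_ : 'I_p) => greedy_step sq z) (enum 'I_p) (A, one) in
  let! u := mul (cst p) (cst p) in
  let! v := mul u z.2 in
  div one v.

(** A method for the matrix formed by the columns of [A] with index in [T], the
    scalar product of [Q] and the accuracy [eps]; the returned [x] is indexed by
    all columns of [A]. *)
Definition solver := forall r n,
  'M[num]_(r, n) -> {set 'I_n} -> 'M[num]_r -> num ->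
  prog ('cV[num]_n * 'cV[num]_r).

(** The Gram matrix [G = A^T Q A] is computed once, and besides [x] and [y] the
    loop maintains [z = A^T Q y], i.e. [z_i] is the [Q]-product of [a_i] and [y].
    With [nrm_i] the [Q]-norm of [a_i], the squared [Q]-norm of [y] is
    [s = \sum_i (x_i / nrm_i) z_i], and, with [zk = z_k / nrm_k], the step length
    [lambda] is [(s - zk) / (s - 2 zk + 1)]. *)
Definition vonNeumann : solver := fun r n A T Q eps =>
  if enum T is k0 :: _ then
    let! QA := mulM Q A in
    let! G := mulM A^T QA in
    let! nrm := tabulate zero (fun i => Sqrt (G i i)) (enum T) in
    let x0 : 'cV[num]_n := \col_i if i == k0 then one else zero in
    let! y0 := build_mx (fun i (_ : 'I_1) => div (A i k0) (nrm k0)) in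
    let! z0 := build_mx (fun i (_ : 'I_1) => div (G i k0) (nrm k0)) in
    Iter (fun xyz : 'cV[num]_n * 'cV[num]_r * 'cV[num]_n =>
      let: (x, y, z) := xyz in
      let! s := sumM (enum T) (fun i =>
        let! u := div (x i ord0) (nrm i) in mul u (z i ord0)) in
      let! ny := Sqrt s in
      let! continue := Less eps ny in
      if ~~ continue then Ret (inr (x, y)) else
      let! pos := tabulate false (fun i => Less zero (z i ord0)) (enum T) in
      if [forall i in T, pos i] then Ret (inr (x, y)) else
      let! k := Choose (fun k => (k \in T) && ~~ pos k) in
      let! zk := div (z k ord0) (nrm k) in
      let! num_l := sub s zk in
      let! den' := sub num_l zk in
      let! den_l := add den' one in
      let! l := div num_l den_l in
      let! l' := sub one l in
      let! x' := build_mx (fun i (_ : 'I_1) =>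
        let! u := mul l' (x i ord0) in if i == k then add u l else Ret u) in
      let! lk := div l (nrm k) in
      let! y' := build_mx (fun i (_ : 'I_1) =>
        let! u := mul l' (y i ord0) in
        let! v := mul lk (A i k) in add u v) in
      let! z' := build_mx (fun i (_ : 'I_1) =>
        let! u := mul l' (z i ord0) in
        let! v := mul lk (G i k) in add u v) in
      Ret (inl (x', y', z')))
    (x0, y0, z0)
  else Ret (zero_mx n 1, zero_mx r 1).

(** Columns are kept in place: those with index outside [T] are the deleted
    ones. *)
Record state m n := State {
  st_r : nat;
  st_A : 'M[num]_(st_r, n);
  st_T : {set 'I_n};
  st_R : 'M[num]_st_r;
  st_Q : 'M[num]_st_r;
  st_U : 'M[num]_(m, st_r) }.

Section Msia.
Variable basis : forall r, 'cV[num]_r -> prog 'M[num]_(r, r.-1).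
Variable solve : solver.
Variables m n : nat.

Definition rescale (eps : num) (st : state m n) (x : 'cV[num]_n) :
    prog (state m n) :=
  let: State r A T R Q U := st in
  let! QA := mulM Q A in
  let! c := tabulate zero (fun i =>
    let! nrm2 := dotM (col i A) (col i QA) in div (x i ord0) nrm2) (enum T) in
  let! e1 := add one eps in
  let! R' := build_mx (fun i j =>
    let! u := sumM (enum T) (fun k =>
      let! v := mul (c k) (A i k) in mul v (A j k)) in
    let! w := add (R i j) u in
    div w e1) in
  let! Q' := inverse R' in
  Ret (State A T R' Q' U).

Definition remove (st : state m n) (k : 'I_n) : prog (state m n) :=
  let: State r A T R Q U := st in
  let! W := basis (col k A) in
  let! A' := mulM W^T A in
  let! T' := nonzero_cols A' T in
  let! RW := mulM R W in
  let! R' := mulM W^T RW in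
  let! U' := mulM U W in
  let! Q' := inverse R' in
  Ret (State A' T' R' Q' U').

Definition remove_loop (theta : num) : state m n -> prog (state m n) :=
  Iter (fun st : state m n =>
    let! QA := mulM (st_Q st) (st_A st) in
    let! small := tabulate false (fun i =>
      let! s := dotM (col i (st_A st)) (col i QA) in
      let! nQ := Sqrt s in
      let! s2 := dotM (col i (st_A st)) (col i (st_A st)) in
      let! n2 := Sqrt s2 in
      let! ratio := div nQ n2 in
      Less ratio theta) (enum (st_T st)) in
    if ~~ [exists i in st_T st, small i] then Ret (inr st) else
    let! k := Choose (fun k => (k \in st_T st) && small k) in
    let! st' := remove st k in
    Ret (inl st')).

(** Zero columns are already deleted at the start: the normalisation of columns
    and the projection along them make sense for nonzero columns only. *)
Definition msia (A0 : 'M[num]_(m, n)) : prog 'cV[num]_m :=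
  let! eps := div one (cst (11 * m)) in
  let! theta := compute_theta A0 in
  let! T0 := nonzero_cols A0 [set: 'I_n] in
  Iter (fun st : state m n =>
    if st_T st == finset.set0 then Ret (inr (zero_mx m 1)) else
    let! (x, y) := solve (st_A st) (st_T st) (st_Q st) eps in
    let! Qy := mulM (st_Q st) y in
    let! z := mulM (st_A st)^T Qy in
    let! pos := tabulate false (fun i => Less zero (z i ord0)) (enum (st_T st)) in
    if [forall i in st_T st, pos i] then
      let! ybar := mulM (st_U st) Qy in Ret (inr ybar)
    else
      let! st1 := rescale eps st x in
      let! st2 := remove_loop theta st1 in
      Ret (inl st2))
  (State A0 T0 (id_mx m) (id_mx m) (id_mx m)).

End Msia.
End Programs.

Arguments vonNeumann {num}.

(** * Specifications *)

Section Specifications.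
Variable R : realType.

Definition real_cst (k : nat) : R := k%:R.

Definition norm2 p (a : 'cV[R]_p) : R := Num.sqrt (\sum_i a i ord0 ^+ 2).

Definition normQ p (Q : 'M[R]_p) (v : 'cV[R]_p) : R :=
  Num.sqrt ((v^T *m Q *m v) ord0 ord0).

Definition sym_posdef p (Q : 'M[R]_p) : Prop :=
  Q^T = Q /\ forall v : 'cV[R]_p, v != 0 -> 0 < (v^T *m Q *m v) ord0 ord0.

Definition cols m n (A : 'M[R]_(m, n)) (B : {set 'I_n}) : 'M[R]_(m, #|B|) :=
  colsub (fun i : 'I_#|B| => enum_val i) A.

Definition DeltaA m n (A : 'M[R]_(m, n)) : R :=
  \big[Num.max/0]_(B : {set 'I_n} | #|B| == \rank (cols A B))
    \prod_(j in B) norm2 (col j A).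

Definition thetaA m n (A : 'M[R]_(m, n)) : R :=
  (m%:R ^+ 2 * DeltaA A ^+ 2)^-1.

Definition orthonormal_basis_of_orth p (a : 'cV[R]_p) (W : 'M[R]_(p, p.-1)) :
    Prop :=
  [/\ W^T *m W = 1%:M, a^T *m W = 0
    & forall v : 'cV[R]_p, a^T *m v = 0 -> exists c, v = W *m c].

(** Any orthonormal basis may be selected; the operations charged for it are
    those of the Householder construction, whose result is one of the possible
    selections. *)
Definition any_basis p (a : 'cV[R]_p) : prog R 'M[R]_(p, p.-1) :=
  let! W0 := householder real_cst a in
  Choose (fun W => W = W0 \/ orthonormal_basis_of_orth a W).

Definition int_mx m n (A : 'M[int]_(m, n)) : 'M[R]_(m, n) :=
  map_mx intr A.

Definition max_support_image_algorithm (solve : solver R) m n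
    (A : 'M[int]_(m, n)) : prog R 'cV[R]_m :=
  msia real_cst any_basis solve (int_mx A).

Definition is_solution m n (A : 'M[R]_(m, n)) (y : 'cV[R]_m) : Prop :=
  forall j, 0 <= (A^T *m y) j ord0.

Definition strict_ineqs m n (A : 'M[R]_(m, n)) (y : 'cV[R]_m) : {set 'I_n} :=
  [set j | 0 < (A^T *m y) j ord0].

(** Its support contains that of every solution; in particular [y] satisfies the
    maximum number of strict inequalities. *)
Definition max_support_solution m n (A : 'M[R]_(m, n)) (y : 'cV[R]_m) : Prop :=
  is_solution A y /\
  forall y', is_solution A y' -> strict_ineqs A y' \subset strict_ineqs A y.

(** [log N], read as [log 2] for [N = 1] so that [sqrt (log N)] is not [0]. *)
Definition log_ge2 (N : nat) : R := ln (maxn N 2)%:R.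

(** The guarantee of the Smoothed Perceptron and Mirror Prox methods.  The last
    summand allows for computing [Q A] before the first iteration. *)
Definition solver_guarantee (solve : solver R) (K : R) : Prop :=
  forall r n (A : 'M[R]_(r, n)) (T : {set 'I_n}) (Q : 'M[R]_r) (eps : R),
  T != finset.set0 -> (forall i, i \in T -> col i A != 0) -> sym_posdef Q -> 0 < eps ->
  forall t0,
  wp (solve r n A T Q eps)
    (fun xy t =>
       let: (x, y) := xy in
       [/\ [/\ forall i, 0 <= x i ord0, forall i, i \notin T -> x i ord0 = 0,
               \sum_(i in T) x i ord0 = 1
             & y = \sum_(i in T) (x i ord0 / normQ Q (col i A)) *: col i A],
           (forall i, i \in T -> 0 < (A^T *m Q *m y) i ord0) \/
             normQ Q y <= eps
         & t%:R <= t0%:R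
             + (K * (Num.sqrt (log_ge2 #|T|) / eps)) * (K * (r%:R * #|T|%:R))
             + K * (r%:R ^+ 2 * #|T|%:R)])
    t0.

End Specifications.

(** Sign bit plus [ceil (log2 (|z| + 1))]. *)
Definition bits (z : int) : nat := (up_log 2 `|z|%N.+1).+1.

Definition encoding_length m n (A : 'M[int]_(m, n)) : nat :=
  (\sum_i \sum_j bits (A i j))%N.

(* Main.v *)
Require Import Defs.
From HB Require Import structures.
From mathcomp Require Import all_boot all_order all_algebra.
From mathcomp Require Import reals exp.
From mathcomp Require Import boolp ring lra zify.

(** The scaled Gram matrix [R] measures progress.  All solutions of norm at most 1
    stay in the ellipsoid [y^T R y <= 1]: for such [y] the numbers
    [a_i^T y / |a_i|_Q] lie in [0, 1], so their squares, weighted by [x], add up to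
    at most [<sum_i x_i a_i / |a_i|_Q, y> <= eps].  Hence a column with
    [|a_k|_Q < theta |a_k|] is orthogonal to all solutions, because a column in the
    support of some solution satisfies [a_k^T y >= |a_k| / Delta] for a solution [y]
    of norm 1: take a solution with [a_k^T y = 1] and as many tight constraints as
    possible, select independent columns [B] containing [a_k] among the tight ones
    and [a_k]; then [|y|^2] is a diagonal entry of the inverse of the integral Gram
    matrix of [B], which is bounded by Hadamard's inequality.

    A rescaling multiplies [det R] by at least 2 / (1 + eps)^m >= 3/2, a removal
    divides it by at most [M = 11 m / theta^2], and [tr R <= M] throughout, so
    [det R <= M^r].  Thus [N] rescalings imply [(3/2)^N <= M^m], and since
    [M <= 2^(13 L)] there are O(m L) of them. *)

Set Implicit Arguments.
Unset Strict Implicit.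
Unset Printing Implicit Defensive.

Import Order.TTheory GRing.Theory Num.Theory.
Local Open Scope ring_scope.

(** * Quadratic forms and determinants *)

(** The value of [M] is forced by the trace: a rescaling turns [\tr R] into at most
    [(\tr R + theta^-2) / (1 + eps)], and the bound [M] reproduces itself exactly when
    [eps * M = theta^-2].

    Removals lower both the dimension and [\det R], so progress is measured by [\det R * M^(m - r)],
    which a removal does not decrease. Deleting columns is harmless because every solution stays in
    the image of [U]: projecting a column keeps its products with all solutions, and a column that
    has become zero is orthogonal to every solution.

    Outside the solver a rescaling costs O(m^2 n) operations; removals are charged to the dimension,
    hence number at most [m] in the whole run. A call of the von Neumann algorithm takes O(m^2)
    steps of O(n) operations after computing a Gram matrix in O(m n^2), and [m <= n] makes this O(m
    n^2). The faster methods take O(m sqrt(log n)) steps of O(m n) operations. *)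

Section InnerProduct.
Variable R : realType.

Definition ip p (u v : 'cV[R]_p) : R := (u^T *m v) ord0 ord0.

Lemma ipE p (u v : 'cV[R]_p) : ip u v = \sum_i u i ord0 * v i ord0.
Proof. by rewrite /ip mxE; apply: eq_bigr => i _; rewrite mxE. Qed.

Lemma ipC p (u v : 'cV[R]_p) : ip u v = ip v u.
Proof. by rewrite !ipE; apply: eq_bigr => i _; rewrite mulrC. Qed.

Lemma ipDr p (u v w : 'cV[R]_p) : ip u (v + w) = ip u v + ip u w.
Proof. by rewrite /ip mulmxDr mxE. Qed.

Lemma ipDl p (u v w : 'cV[R]_p) : ip (v + w) u = ip v u + ip w u.
Proof. by rewrite ipC ipDr ipC (ipC u w). Qed.

Lemma ipZr p a (u v : 'cV[R]_p) : ip u (a *: v) = a * ip u v.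
Proof. by rewrite /ip -scalemxAr mxE. Qed.

Lemma ipZl p a (u v : 'cV[R]_p) : ip (a *: u) v = a * ip u v.
Proof. by rewrite ipC ipZr ipC. Qed.

Lemma ipNr p (u v : 'cV[R]_p) : ip u (- v) = - ip u v.
Proof. by rewrite -scaleN1r ipZr mulN1r. Qed.

Lemma ipNl p (u v : 'cV[R]_p) : ip (- u) v = - ip u v.
Proof. by rewrite ipC ipNr ipC. Qed.

Lemma ip0r p (u : 'cV[R]_p) : ip u 0 = 0.
Proof. by rewrite /ip mulmx0 mxE. Qed.

Lemma ip0l p (u : 'cV[R]_p) : ip 0 u = 0.
Proof. by rewrite ipC ip0r. Qed.

Lemma ip_sumr p I (s : seq I) (P : pred I) (u : 'cV[R]_p) (F : I -> 'cV[R]_p) :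
  ip u (\sum_(i <- s | P i) F i) = \sum_(i <- s | P i) ip u (F i).
Proof.
by apply: (big_morph (ip u)); [move=> x y; rewrite ipDr | rewrite ip0r].
Qed.

Lemma ip_suml p I (s : seq I) (P : pred I) (u : 'cV[R]_p) (F : I -> 'cV[R]_p) :
  ip (\sum_(i <- s | P i) F i) u = \sum_(i <- s | P i) ip (F i) u.
Proof. by rewrite ipC ip_sumr; apply: eq_bigr => i _; rewrite ipC. Qed.

Lemma ip_mulr p q (M : 'M[R]_(p, q)) u v : ip u (M *m v) = ip (M^T *m u) v.
Proof. by rewrite /ip trmx_mul trmxK mulmxA. Qed.

Lemma ip_mull p q (M : 'M[R]_(p, q)) u v : ip (M *m u) v = ip u (M^T *m v).
Proof. by rewrite ip_mulr trmxK. Qed.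

Lemma ip_delta p (u : 'cV[R]_p) i : ip u (delta_mx i ord0) = u i ord0.
Proof.
rewrite ipE (bigD1 i) //= big1 => [|j ji]; first by rewrite mxE !eqxx mulr1 addr0.
by rewrite mxE (negPf ji) mulr0.
Qed.

Lemma ip_ge0 p (u : 'cV[R]_p) : 0 <= ip u u.
Proof. by rewrite ipE; apply: sumr_ge0 => i _; rewrite -expr2 sqr_ge0. Qed.

Lemma ip_eq0 p (u : 'cV[R]_p) : (ip u u == 0) = (u == 0).
Proof.
apply/eqP/eqP => [|->]; last by rewrite ip0r.
rewrite ipE => /eqP; rewrite psumr_eq0 => [/allP u0|i _]; last by rewrite -expr2 sqr_ge0.
apply/colP => i; rewrite mxE; have := u0 i (mem_index_enum _).
by rewrite -expr2 sqrf_eq0 => /eqP.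
Qed.

Lemma ip_gt0 p (u : 'cV[R]_p) : (0 < ip u u) = (u != 0).
Proof. by rewrite lt_def ip_eq0 ip_ge0 andbT. Qed.

Lemma ip_col p q (A : 'M[R]_(p, q)) j v : ip (col j A) v = (A^T *m v) j ord0.
Proof. by rewrite ipE mxE; apply: eq_bigr => i _; rewrite !mxE. Qed.

Lemma entry_ip_col p q r (A : 'M[R]_(p, q)) (B : 'M[R]_(p, r)) i j :
  (A^T *m B) i j = ip (col i A) (col j B).
Proof. by rewrite ipE mxE; apply: eq_bigr => k _; rewrite !mxE. Qed.

Definition psd p (S : 'M[R]_p) : Prop :=
  S^T = S /\ forall v, 0 <= ip v (S *m v).

Lemma posdef_gt0 p (Q : 'M[R]_p) v : sym_posdef Q -> v != 0 -> 0 < ip v (Q *m v).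
Proof. by case=> _ pQ /pQ; rewrite /ip mulmxA. Qed.

Lemma posdefI p (Q : 'M[R]_p) :
  Q^T = Q -> (forall v, v != 0 -> 0 < ip v (Q *m v)) -> sym_posdef Q.
Proof. by move=> QT pQ; split => // v /pQ; rewrite /ip mulmxA. Qed.

Lemma posdef_psd p (Q : 'M[R]_p) : sym_posdef Q -> psd Q.
Proof.
move=> pQ; split=> [|v]; first by case: pQ.
have [->|v0] := eqVneq v 0; first by rewrite mulmx0 ip0r.
exact/ltW/posdef_gt0.
Qed.

(** The form may be degenerate, so nothing can be divided by [a] or [g] at once: the vectors
    [b u - a v] and [g u - b v] settle the cases [a > 0] and [g > 0], and if both vanish, [u - b v]
    gives [-2 b^2 >= 0]. *)
Lemma psd_CS p (S : 'M[R]_p) u v :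
  psd S -> ip u (S *m v) ^+ 2 <= ip u (S *m u) * ip v (S *m v).
Proof.
move=> [ST S0].
set a := ip u (S *m u); set g := ip v (S *m v); set b := ip u (S *m v).
have bC : ip v (S *m u) = b by rewrite ip_mulr ST ipC.
have E x y : ip (x *: u + y *: v) (S *m (x *: u + y *: v)) =
    x ^+ 2 * a + 2 * (x * y) * b + y ^+ 2 * g.
  rewrite mulmxDr -!scalemxAr !ipDr !ipDl !ipZr !ipZl bC -/a -/b -/g; ring.
have h1 := S0 (b *: u + (- a) *: v); rewrite E in h1.
have h2 := S0 (g *: u + (- b) *: v); rewrite E in h2.
have h3 := S0 (1 *: u + (- b) *: v); rewrite E in h3.
have a0 : 0 <= a by exact: S0.
have g0 : 0 <= g by exact: S0.
rewrite -subr_ge0.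
have [a1|a1] := ltrP 0 a.
  have : 0 <= a * (a * g - b ^+ 2) by apply: le_trans h1 _; rewrite le_eqVlt; apply/orP; left; apply/eqP; ring.
  by rewrite pmulr_rge0.
have [g1|g1] := ltrP 0 g.
  have : 0 <= g * (a * g - b ^+ 2) by apply: le_trans h2 _; rewrite le_eqVlt; apply/orP; left; apply/eqP; ring.
  by rewrite pmulr_rge0.
have ea : a = 0 by apply/eqP; rewrite eq_le a1 a0.
have eg : g = 0 by apply/eqP; rewrite eq_le g1 g0.
move: h3; rewrite ea eg; nra.
Qed.

(** Cauchy-Schwarz for [S], applied to [Q u] and [v], since [u^T v = (Q u)^T S v]. *)
Lemma ip_CS p (Q S : 'M[R]_p) u v : sym_posdef S -> S *m Q = 1%:M ->
  ip u v ^+ 2 <= ip u (Q *m u) * ip v (S *m v).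
Proof.
move=> pS SQ; have [ST _] := pS.
have := psd_CS (Q *m u) v (posdef_psd pS).
rewrite mulmxA SQ mul1mx !ip_mull.
have QT : Q^T *m S = 1%:M by rewrite -[S]ST -trmx_mul SQ trmx1.
rewrite (_ : ip u (Q^T *m (S *m v)) = ip u v); last by rewrite mulmxA QT mul1mx.
by rewrite (_ : ip u (Q^T *m u) = ip u (Q *m u)) // -ip_mull ipC.
Qed.

Lemma posdef_inv p (S Q : 'M[R]_p) : sym_posdef S -> S *m Q = 1%:M -> sym_posdef Q.
Proof.
move=> pS SQ; have [ST _] := pS.
have QT : Q^T *m S = 1%:M by rewrite -[S]ST -trmx_mul SQ trmx1.
have QTQ : Q^T = Q by rewrite -[Q^T]mulmx1 -SQ mulmxA QT mul1mx.
apply: posdefI => // v v0.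
have Qv0 : Q *m v != 0.
  by apply: contraNneq v0 => Qv; rewrite -[v]mul1mx -SQ -mulmxA Qv mulmx0.
have := posdef_gt0 pS Qv0; rewrite ip_mull QTQ.
by rewrite (mulmxA S) SQ mul1mx.
Qed.

Lemma posdef_cong p q (S : 'M[R]_p) (W : 'M[R]_(p, q)) :
  sym_posdef S -> (forall v : 'cV[R]_q, W *m v = 0 -> v = 0) -> sym_posdef (W^T *m (S *m W)).
Proof.
move=> pS W0; have [ST _] := pS; apply: posdefI => [|v v0].
  by rewrite !trmx_mul trmxK ST mulmxA.
rewrite -!mulmxA -ip_mull; apply: posdef_gt0 => //.
by apply: contraNneq v0 => /W0 ->.
Qed.

Lemma posdef1 p : sym_posdef (1%:M : 'M[R]_p).
Proof.
by apply: posdefI => [|v v0]; rewrite ?trmx1 // mul1mx ip_gt0.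
Qed.

Lemma gram_posdef p q (C : 'M[R]_(p, q)) :
  (forall v : 'cV[R]_q, C *m v = 0 -> v = 0) -> sym_posdef (C^T *m C).
Proof.
by move=> C0; rewrite -[X in _ *m X]mul1mx; apply: posdef_cong => //; exact: posdef1.
Qed.

Lemma posdef_diag p (S : 'M[R]_p) i : sym_posdef S -> 0 < S i i.
Proof.
move=> pS; have d0 : (delta_mx i ord0 : 'cV[R]_p) != 0.
  apply/eqP => /matrixP/(_ i ord0); rewrite !mxE !eqxx => /eqP.
  by rewrite oner_eq0.
by have := posdef_gt0 pS d0; rewrite -colE ipC ip_delta mxE.
Qed.

End InnerProduct.

(** * Schur complements and determinant inequalities *)

Section Determinants.
Variable R : realType.

Definition schur n (M : 'M[R]_(1 + n)) : 'M[R]_n :=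
  drsubmx M - (M ord0 ord0)^-1 *: (dlsubmx M *m ursubmx M).

Lemma ulsubmx11 n (M : 'M[R]_(1 + n)) : ulsubmx M = (M ord0 ord0)%:M.
Proof.
by apply/matrixP => i j; rewrite !ord1 !mxE eqxx mulr1n; congr (M _ _); apply: val_inj.
Qed.

Lemma det_schur n (M : 'M[R]_(1 + n)) :
  M ord0 ord0 != 0 -> \det M = M ord0 ord0 * \det (schur M).
Proof.
move=> a0; set a := M ord0 ord0.
have {1}-> : M = block_mx 1%:M 0 (a^-1 *: dlsubmx M) 1%:M *m
                 block_mx a%:M (ursubmx M) 0 (schur M).
  rewrite mulmx_block !mul1mx !mul0mx !addr0.
  rewrite -[LHS]submxK ulsubmx11 -/a; congr block_mx.
    by rewrite -scalemxAl mul_mx_scalar scalerA mulVf ?scale1r.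
  by rewrite /schur -/a -scalemxAl addrC subrK.
by rewrite det_mulmx det_lblock det_ublock !det1 !mul1r det_scalar1.
Qed.

Lemma col_mx_quad n (M : 'M[R]_(1 + n)) (x : R) (w : 'cV[R]_n) : M^T = M ->
  ip (col_mx x%:M w) (M *m col_mx x%:M w) =
  x ^+ 2 * M ord0 ord0 + 2 * x * ip (dlsubmx M) w + ip w (drsubmx M *m w).
Proof.
move=> MT.
have ur : ursubmx M = (dlsubmx M)^T by rewrite trmx_dlsub MT.
rewrite -{1}[M]submxK ulsubmx11 ur mul_block_col.
rewrite /ip tr_col_mx mul_row_col mxE tr_scalar_mx mul_scalar_mx mxE.
rewrite mul_scalar_mx !mulmxDr mul_mx_scalar -scalemxAr !mxE.
rewrite (_ : (\sum_j w^T ord0 j * dlsubmx M j ord0) = (\sum_j (dlsubmx M)^T ord0 j * w j ord0)).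
  by rewrite eqxx /= mulr1n; ring.
by apply: eq_bigr => i _; rewrite mulrC !mxE.
Qed.

Lemma schur_quad n (M : 'M[R]_(1 + n)) (w : 'cV[R]_n) :
  M^T = M ->
  ip w (schur M *m w) = ip w (drsubmx M *m w) - (M ord0 ord0)^-1 * ip (dlsubmx M) w ^+ 2.
Proof.
move=> MT; have ur : ursubmx M = (dlsubmx M)^T by rewrite trmx_dlsub MT.
rewrite /schur mulmxBl ipDr ipNr -scalemxAl ipZr ur -mulmxA; congr (_ - _ * _).
have -> : (dlsubmx M)^T *m w = (ip (dlsubmx M) w)%:M by rewrite [LHS]mx11_scalar.
by rewrite mul_mx_scalar ipZr (ipC w).
Qed.

Lemma schur_sym n (M : 'M[R]_(1 + n)) : M^T = M -> (schur M)^T = schur M.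
Proof.
move=> MT; rewrite /schur linearB linearZ /= trmx_mul.
by rewrite trmx_drsub trmx_dlsub trmx_ursub MT.
Qed.

Lemma drsubmx_diag n (M : 'M[R]_(1 + n)) i : drsubmx M i i = M (lift ord0 i) (lift ord0 i).
Proof. by rewrite !mxE; congr (M _ _); apply: val_inj. Qed.

(** The form of the Schur complement at [w] is the minimum of the form of [N] over the first
    coordinate; [x] is the minimiser. *)
Lemma schur_posdef n (N : 'M[R]_(1 + n)) : sym_posdef N -> sym_posdef (schur N).
Proof.
move=> pN; have [NT _] := pN; have a0 := posdef_diag ord0 pN.
apply: posdefI => [|w w0]; first exact: schur_sym.
rewrite schur_quad //.
pose x := - (N ord0 ord0)^-1 * ip (dlsubmx N) w.
have : 0 < ip (col_mx x%:M w) (N *m col_mx x%:M w).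
  apply: posdef_gt0 => //; apply: contraNneq w0 => /(congr1 dsubmx).
  by rewrite col_mxKd linear0 => ->.
rewrite col_mx_quad // /x.
by congr (_ < _); field; rewrite gt_eqF.
Qed.

Lemma hadamard n (M : 'M[R]_n) : sym_posdef M -> \det M <= \prod_i M i i.
Proof.
elim: n M => [|n IH] M pM; first by rewrite det_mx00 big_ord0.
have a0 := posdef_diag ord0 pM; have [MT _] := pM.
rewrite (@det_schur n M) ?gt_eqF // big_ord_recl ler_pM2l //.
set N : 'M_(1 + n) := M in a0 MT *.
have pS : sym_posdef (schur N) by apply: schur_posdef.
apply: le_trans (IH _ pS) _; apply: ler_prod => i _.
have ur : ursubmx N = (dlsubmx N)^T by rewrite trmx_dlsub MT.
rewrite ltW ?posdef_diag //= /schur ur mxE drsubmx_diag.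
rewrite !mxE big_ord1 !mxE gerDl oppr_le0 -expr2.
by rewrite mulr_ge0 ?invr_ge0 ?(ltW a0) // sqr_ge0.
Qed.

(** In terms of eigenvalues this compares a product of factors [1 + l_i] with [1 + sum l_i].
    Induction replaces the spectral theorem: the Schur complement of [1 + S] is again [1 + C'] with
    [C'] semidefinite. *)
Lemma det_1D_psd n (S : 'M[R]_n) : psd S -> 1 + \tr S <= \det (1%:M + S).
Proof.
elim: n S => [|n IH] S pS; first by rewrite /mxtrace big_ord0 det_mx00 addr0.
have [ST S0] := pS; set N : 'M_(1 + n) := S in pS ST S0 *.
have s0 : 0 <= N ord0 ord0.
  by have := S0 (delta_mx ord0 ord0); rewrite -colE ipC ip_delta mxE.
set s := N ord0 ord0 in s0 *; set b := dlsubmx N; set C := drsubmx N.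
(* Cauchy-Schwarz between the first unit vector and [(0, w)]. It yields both the semidefiniteness of
   [C'] and, on unit vectors, [|b|^2 <= s * \tr C]. *)
have CS w : ip b w ^+ 2 <= s * ip w (C *m w).
  have := psd_CS (col_mx 1%:M 0) (col_mx 0 w) pS.
  have := col_mx_quad 1 0 ST; have := col_mx_quad 0 w ST.
  rewrite ip0r mulmx0 ip0r raddf0 !mulr0 mul0r !expr0n expr1n /= mul0r !add0r !addr0 mul1r.
  move=> -> ->.
  rewrite -/s -/C; congr (_ ^+ 2 <= _).
  rewrite -[N]submxK mul_block_col !mulmx0 !add0r /ip tr_col_mx mul_row_col.
  rewrite trmx0 mul0mx addr0 trmx1 mul1mx.
  have ur : ursubmx N = (dlsubmx N)^T by rewrite trmx_dlsub ST.
  by rewrite ur.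
pose M : 'M_(1 + n) := @GRing.add 'M_(1 + n) 1%:M N.
rewrite -[X in \det X]/M.
have M00 : M ord0 ord0 = 1 + s by rewrite !mxE eqxx.
have MT : M^T = M by rewrite linearD /= trmx1 ST.
have MB : M = block_mx (1%:M + ulsubmx N) (ursubmx N) b (1%:M + C).
  by rewrite /M -[in LHS](submxK N) (scalar_mx_block 1 n) add_block_mx !add0r.
have dr : drsubmx M = 1%:M + C by rewrite MB block_mxKdr.
have dl : dlsubmx M = b by rewrite MB block_mxKdl.
have s1 : 0 < 1 + s by rewrite ltr_pwDl.
rewrite (@det_schur n M) M00 ?gt_eqF //.
pose C' := C - (1 + s)^-1 *: (b *m b^T).
have ST' : schur M = 1%:M + C'.
  have ur : ursubmx M = b^T by rewrite -dl trmx_dlsub MT.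
  by rewrite /schur M00 dr dl ur /C' addrA.
have pC' : psd C'.
  split=> [|w].
    have : (schur M)^T = schur M by apply: schur_sym.
    by rewrite ST' linearD /= trmx1 => /addrI.
  have := schur_quad w MT; rewrite ST' M00 dr dl !mulmxDl !mul1mx !ipDr -addrA => /addrI ->.
  rewrite subr_ge0 mulrC ler_pdivrMr //; apply: le_trans (CS w) _.
  rewrite mulrC ler_wpM2l ?ler_wpDl ?lerDr //.
  have := S0 (col_mx 0%:M w); rewrite col_mx_quad //.
  by rewrite expr0n /= mulr0 !mul0r !add0r.
rewrite ST'.
have le1 := IH _ pC'.
have trS : \tr N = s + \tr C.
  by rewrite -[N]submxK mxtrace_block ulsubmx11 mxtrace_scalar mulr1n.
have trC' : \tr C' = \tr C - (1 + s)^-1 * ip b b.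
  by rewrite /C' mxtraceD raddfN /= mxtraceZ mxtrace_mulC trace_mx11.
have bb : ip b b <= s * \tr C.
  rewrite ipE /mxtrace mulr_sumr; apply: ler_sum => i _.
  have := CS (delta_mx i ord0).
  by rewrite ip_delta -colE (ipC (delta_mx _ _)) ip_delta [col _ _ _ _]mxE expr2.
apply: le_trans (_ : (1 + s) * (1 + \tr C') <= _); last by rewrite ler_pM2l.
rewrite -/N trS trC' mulrDr mulr1 mulrBr mulrA mulfV ?gt_eqF // mul1r.
move: bb; nra.
Qed.

(** Both sides are the determinant of one block matrix, factored into block triangular matrices in
    two ways. *)
Lemma sylvester p q (A : 'M[R]_(p, q)) (B : 'M[R]_(q, p)) :
  \det (1%:M + A *m B) = \det (1%:M + B *m A).
Proof.
transitivity (\det (block_mx 1%:M (- A) B 1%:M)).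
  have -> : block_mx 1%:M (- A) B 1%:M =
      block_mx 1%:M (- A) 0 1%:M *m block_mx (1%:M + A *m B) 0 B 1%:M.
    rewrite mulmx_block !mul1mx !mul0mx !mulmx1 ?mulmx0 !add0r mulNmx.
    by rewrite addrK.
  by rewrite det_mulmx det_lblock det_ublock !det1 !mul1r mulr1.
have -> : block_mx 1%:M (- A) B 1%:M =
    block_mx 1%:M 0 B 1%:M *m block_mx 1%:M (- A) 0 (1%:M + B *m A).
  rewrite mulmx_block !mul1mx !mul0mx !mulmx1 ?mulmx0 !addr0 mulmxN.
  by rewrite addrC addrK.
by rewrite det_mulmx det_lblock det_ublock !det1 !mul1r.
Qed.

(** Factor out [S] and move [B^T] to the front by [sylvester]. In a rescaling the trace equals
    [sum_k x_k = 1], which is the origin of the factor 2. *)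
Lemma det_posdefD p q (S Q : 'M[R]_p) (B : 'M[R]_(p, q)) :
  sym_posdef S -> S *m Q = 1%:M -> 0 <= \det S ->
  \det S * (1 + \tr (B^T *m (Q *m B))) <= \det (S + B *m B^T).
Proof.
move=> pS SQ dS; have pQ := posdef_inv pS SQ.
have -> : S + B *m B^T = S *m (1%:M + (Q *m B) *m B^T).
  by rewrite mulmxDr mulmx1 !mulmxA SQ mul1mx.
rewrite det_mulmx ler_wpM2l // sylvester; apply: det_1D_psd.
have [QT _] := pQ; split=> [|v]; first by rewrite !trmx_mul trmxK QT mulmxA.
by rewrite -!mulmxA -ip_mull; case: (posdef_psd pQ).
Qed.

Lemma det_posdef_gt0 n (M : 'M[R]_n) : sym_posdef M -> 0 < \det M.
Proof.
elim: n M => [|n IH] M pM; first by rewrite det_mx00.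
have a0 := posdef_diag ord0 pM; have [MT _] := pM.
rewrite (@det_schur n M) ?gt_eqF // mulr_gt0 //.
set N : 'M_(1 + n) := M in a0 MT *.
exact/IH/schur_posdef.
Qed.

End Determinants.

(** * Restricting a quadratic form to a hyperplane *)

Section OrthogonalComplement.
Variable R : realType.

(** Cramer's rule: [M] times the identity with its first column replaced by that of [N] is [M] with
    its first column replaced by the first unit vector. *)
Lemma det_minor_inv n (M N : 'M[R]_(1 + n)) :
  M *m N = 1%:M -> \det (drsubmx M) = \det M * N ord0 ord0.
Proof.
move=> MN.
have E : M *m block_mx (ulsubmx N) 0 (dlsubmx N) 1%:M =
         block_mx 1%:M (ursubmx M) 0 (drsubmx M).
  have : M *m N = block_mx 1%:M 0 0 1%:M by rewrite MN -scalar_mx_block.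
  rewrite -{1}[M]submxK -{1}[N]submxK mulmx_block.
  case/eq_block_mx => e1 _ e3 _.
  by rewrite -{1}[M]submxK mulmx_block !mulmx0 !mulmx1 !add0r e1 e3.
have := congr1 (fun X : 'M[R]_(1 + n) => \det X) E.
by rewrite det_mulmx det_lblock det_ublock !det1 mulr1 mul1r ulsubmx11 det_scalar1 => <-.
Qed.

Variable p : nat.
Variables (a : 'cV[R]_p.+1) (W : 'M[R]_(p.+1, p)).
Hypotheses (a0 : a != 0) (WW : W^T *m W = 1%:M) (aW : a^T *m W = 0).

Let s := (Num.sqrt (ip a a))^-1.
Let P : 'M[R]_(1 + p) := row_mx (s *: a) W.

Let ss : s ^+ 2 * ip a a = 1.
Proof. by rewrite /s exprVn sqr_sqrtr ?ip_ge0 // mulVf ?ip_eq0. Qed.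

Let trZ : (s *: a)^T = s *: a^T. Proof. exact: linearZ. Qed.

Let PtP : P^T *m P = 1%:M.
Proof.
rewrite /P tr_row_mx mul_col_row (scalar_mx_block 1 p) WW trZ.
rewrite -!scalemxAl aW scaler0.
congr block_mx.
  by rewrite [LHS]mx11_scalar mxE -scalemxAr mxE -/(ip a a) mulrA -expr2 ss.
by rewrite -scalemxAr -[W^T *m a]trmxK trmx_mul trmxK aW trmx0 scaler0.
Qed.

Lemma orth_complement_proj v : ip a v = 0 -> v = W *m (W^T *m v).
Proof.
move=> av; have := mulmx1C PtP; rewrite /P tr_row_mx mul_row_col => /(congr1 (mulmx^~ v)).
rewrite mulmxDl mul1mx -!mulmxA trZ -!scalemxAl.
have -> : a^T *m v = 0 by rewrite [LHS]mx11_scalar -/(ip a v) av raddf0.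
by rewrite scaler0 mulmx0 scaler0 add0r.
Qed.

Let PSP (S : 'M[R]_p.+1) : P^T *m (S *m P) =
  block_mx (s ^+ 2 * ip a (S *m a))%:M (s *: a^T *m (S *m W))
           (s *: W^T *m (S *m a)) (W^T *m (S *m W)).
Proof.
rewrite /P mul_mx_row tr_row_mx mul_col_row trZ -!scalemxAl -!scalemxAr.
congr block_mx.
by rewrite scalerA [LHS]mx11_scalar mxE -expr2.
Qed.

(** In the orthonormal basis [P], made of [a / |a|] and [W], the restricted form is the lower right
    block of [P^T S P], whose determinant is [\det S] and whose inverse is [P^T Q P]. *)
Lemma det_orth_complement (S Q : 'M[R]_p.+1) : S *m Q = 1%:M ->
  \det (W^T *m (S *m W)) * ip a a = \det S * ip a (Q *m a).
Proof.
move=> SQ.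
have MN : (P^T *m (S *m P)) *m (P^T *m (Q *m P)) = 1%:M.
  rewrite -!mulmxA (mulmxA P) (mulmx1C PtP) mul1mx (mulmxA S) SQ mul1mx.
  exact: PtP.
have := det_minor_inv MN; rewrite [in X in X = _]PSP block_mxKdr => ->.
have -> : (P^T *m (Q *m P)) ord0 ord0 = s ^+ 2 * ip a (Q *m a).
  have := ulsubmx11 (P^T *m (Q *m P)); rewrite {1}PSP block_mxKul => /matrixP/(_ ord0 ord0).
  by rewrite [LHS]mxE [RHS]mxE !eqxx !mulr1n.
have -> : \det (P^T *m (S *m P)) = \det S.
  rewrite !det_mulmx mulrCA -det_mulmx.
  by rewrite PtP det1 mulr1.
by rewrite -mulrA mulrAC ss mul1r.
Qed.

Lemma trace_orth_complement (S : 'M[R]_p.+1) :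
  \tr (W^T *m (S *m W)) * ip a a + ip a (S *m a) = \tr S * ip a a.
Proof.
have <- : \tr (P^T *m (S *m P)) = \tr S.
  by rewrite mxtrace_mulC -mulmxA (mulmx1C PtP) mulmx1.
rewrite PSP mxtrace_block mxtrace_scalar mulr1n mulrDl addrC mulrAC ss mul1r.
by [].
Qed.

End OrthogonalComplement.

(** * Cost-bounded correctness of programs *)

Section ProgramLogic.
Variable R : realType.

Lemma wp_mono B (p : prog R B) (post post' : B -> nat -> Prop) t :
  (forall v t', post v t' -> post' v t') -> wp p post t -> wp p post' t.
Proof.
elim: p post post' t => /=.
- by move=> {}B b post post' t; apply.
- move=> {}B C p IHp f IHf post post' t le; apply: IHp => v t'.
  exact: IHf.
- by move=> o x y post post' t le [H /le].
- by move=> x post post' t le [H /le].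
- by move=> x y post post' t; apply.
- by move=> {}B P post post' t le [ex all]; split=> // v /all/le.
- move=> X {}B body IH s0 post post' t le H I HI; apply: H => s t' Hs.
  apply: HI; apply: IH Hs => -[s'|b] t'' //; exact: le.
Qed.

(** Total correctness with a variant: induction on [k] shows that any predicate closed under the
    loop body, hence the least fixed point, holds at the start. *)
Lemma wp_iter (X B : Type) (body : X -> prog R (X + B)) (Inv : nat -> X -> nat -> Prop)
    (post : B -> nat -> Prop) k s t :
  (forall k s t, Inv k s t ->
     wp (body s) (fun v t' => match v with
                              | inl s' => exists2 k', (k' < k)%N & Inv k' s' t'
                              | inr b => post b t'
                              end) t) ->
  Inv k s t -> wp (Iter body s) post t.
Proof.
move=> Hbody Inv0 I HI.
elim/ltn_ind: k s t Inv0 => k IH s t /Hbody Hs.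
apply: HI; apply: wp_mono Hs => -[s'|b] t' //.
by case=> k' /IH; apply.
Qed.

Lemma wp_bind B C (p : prog R B) (f : B -> prog R C) post1 post t :
  wp p post1 t -> (forall v t', post1 v t' -> wp (f v) post t') -> wp (Bind p f) post t.
Proof. by move=> H1 H; apply: wp_mono H1. Qed.

(** Quantifying over the initial counter makes the bounds add up under sequencing. *)
Definition spec (c : nat) B (p : prog R B) (P : B -> Prop) : Prop :=
  forall t, wp p (fun v t' => P v /\ (t' <= t + c)%N) t.

Lemma wp_bind_spec c B C (p : prog R B) (f : B -> prog R C) P post t :
  spec c p P ->
  (forall v t', P v -> (t' <= t + c)%N -> wp (f v) post t') ->
  wp (Bind p f) post t.
Proof. by move=> sp H; apply: wp_mono (sp t) => v t' []; exact: H. Qed.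

Lemma wp_spec c B (p : prog R B) P (post : B -> nat -> Prop) t :
  spec c p P ->
  (forall v t', P v -> (t' <= t + c)%N -> post v t') -> wp p post t.
Proof. by move=> sp H; apply: wp_mono (sp t) => v t' []; exact: H. Qed.

Lemma spec_bind c c' B C (p : prog R B) (f : B -> prog R C) P P' :
  spec c p P -> (forall v, P v -> spec c' (f v) P') -> spec (c + c')%N (Bind p f) P'.
Proof.
move=> sp sf t; apply: wp_bind_spec sp _ => v t' Pv le.
by apply: wp_spec (sf v Pv) _ => w t'' Pw le'; split=> //; lia.
Qed.

Lemma spec_weaken c c' B (p : prog R B) (P P' : B -> Prop) :
  spec c p P -> (forall v, P v -> P' v) -> (c <= c')%N -> spec c' p P'.
Proof.
move=> sp PP' cc' t; apply: wp_spec (sp) _ => v t' Pv le.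
by split; [exact: PP' | lia].
Qed.

Lemma spec_ret B (v : B) : spec 0 (Ret v) (eq^~ v).
Proof. by move=> t; split; rewrite ?addn0. Qed.

Lemma spec_add (x y : R) : spec 1 (Defs.add x y) (eq^~ (x + y)).
Proof. by move=> t; split=> //=; split=> //; rewrite addn1. Qed.

Lemma spec_sub (x y : R) : spec 1 (Defs.sub x y) (eq^~ (x - y)).
Proof. by move=> t; split=> //=; split=> //; rewrite addn1. Qed.

Lemma spec_mul (x y : R) : spec 1 (Defs.mul x y) (eq^~ (x * y)).
Proof. by move=> t; split=> //=; split=> //; rewrite addn1. Qed.

Lemma spec_div (x y : R) : y != 0 -> spec 1 (Defs.div x y) (eq^~ (x / y)).
Proof. by move=> y0 t; split=> //=; split=> //; rewrite addn1. Qed.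

Lemma spec_sqrt (x : R) : 0 <= x -> spec 1 (Sqrt x) (eq^~ (Num.sqrt x)).
Proof. by move=> x0 t; split=> //=; split=> //; rewrite addn1. Qed.

Lemma spec_less (x y : R) : spec 1 (Less x y) (eq^~ (x < y)).
Proof. by move=> t; split=> //=; rewrite addn1. Qed.

Lemma wp_choose B C (P : B -> Prop) (f : B -> prog R C) post t :
  (exists v, P v) -> (forall v, P v -> wp (f v) post t) -> wp (Bind (Choose P) f) post t.
Proof. by move=> ex H; split. Qed.

(** The invariant is indexed by the processed prefix, and each step knows how [s] splits: inversion
    relies on this to see that the current pivot is not in the prefix. *)
Lemma spec_foldM (I : eqType) X (f : X -> I -> prog R X) (s : seq I) c z
    (J : seq I -> X -> Prop) :
  (forall z i s1 s2, s = s1 ++ i :: s2 -> J s1 z -> spec c (f z i) (J (rcons s1 i))) ->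
  J [::] z -> spec (c * size s) (foldM f s z) (J s).
Proof.
move=> Hf; rewrite -[X in J X](cat0s [::]).
suff H s1 s2 : s = s1 ++ s2 -> forall y, J s1 y -> spec (c * size s2) (foldM f s2 y) (J s).
  by move=> J0; apply: (H [::]).
elim: s2 s1 => [|i s2 IH] s1 es y Jy /=.
  by apply: spec_weaken (spec_ret _) _ _ => // v ->; rewrite es cats0.
rewrite mulnS; apply: spec_bind (Hf _ _ _ _ es Jy) _ => v.
by apply: IH; rewrite es cat_rcons.
Qed.

Lemma spec_tabulate (I : eqType) B (d : B) (f : I -> prog R B) (s : seq I) c
    (P : I -> B -> Prop) :
  (forall i, i \in s -> spec c (f i) (P i)) ->
  spec (c * size s) (tabulate d f s)
    (fun g => (forall i, i \in s -> P i (g i)) /\ (forall i, i \notin s -> g i = d)).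
Proof.
elim: s => [|i s IH] Hf /=.
  by apply: spec_weaken (spec_ret _) _ _ => // v ->.
rewrite mulnS; apply: spec_bind (Hf i (mem_head _ _)) _ => v Pv.
rewrite -[(_ * _)%N]addn0; apply: spec_bind (IH _) _ => [j js|g [g1 g2]].
  by apply: Hf; rewrite inE js orbT.
apply: spec_weaken (spec_ret _) _ _ => // _ ->; split=> j; rewrite inE.
  by case: eqP => [-> //|_ /= /g1].
by case: eqP => //= _ /g2.
Qed.

Lemma spec_tabulate_fun (I : eqType) B (d : B) (f : I -> prog R B) (s : seq I) c F :
  (forall i, i \in s -> spec c (f i) (eq^~ (F i))) ->
  spec (c * size s) (tabulate d f s) (fun g => forall i, i \in s -> g i = F i).
Proof. by move=> Hf; apply: spec_weaken (spec_tabulate _ Hf) _ _ => // v []. Qed.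

Notation cst := (@real_cst R).

Lemma spec_sumM (I : eqType) (s : seq I) (f : I -> prog R R) F c :
  (forall i, i \in s -> spec c (f i) (eq^~ (F i))) ->
  spec (c.+1 * size s) (sumM cst s f) (eq^~ (\sum_(i <- s) F i)).
Proof.
move=> Hf; rewrite /sumM.
apply: (spec_foldM (J := fun s1 z => z = \sum_(i <- s1) F i)); last by rewrite big_nil.
move=> z i s1 s2 es ->; rewrite -addn1; apply: spec_bind (Hf i _) _ => [|_ ->].
  by rewrite es mem_cat mem_head orbT.
by apply: spec_weaken (spec_add _ _) _ _ => // _ ->; rewrite -cats1 big_cat big_seq1.
Qed.

Lemma spec_build_mx p q (f : 'I_p -> 'I_q -> prog R R) F c :
  (forall i j, spec c (f i j) (eq^~ (F i j))) ->
  spec (c * (p * q)) (build_mx cst f) (eq^~ (\matrix_(i, j) F i j)).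
Proof.
move=> Hf; rewrite /build_mx -[(_ * _)%N]addn0.
have -> : (p * q)%N = size (enum {: 'I_p * 'I_q}) by rewrite -cardE card_prod !card_ord.
apply: spec_bind (spec_tabulate_fun (F := fun ij => F ij.1 ij.2) _ _) _ => // g Hg.
apply: spec_weaken (spec_ret _) _ _ => // _ ->.
by apply/matrixP => i j; rewrite !mxE Hg ?mem_enum.
Qed.

Lemma spec_mulM p q s (A : 'M[R]_(p, q)) (B : 'M[R]_(q, s)) :
  spec (2 * q * (p * s)) (mulM cst A B) (eq^~ (A *m B)).
Proof.
rewrite /mulM; apply: spec_weaken (spec_build_mx (F := fun i j => \sum_(k <- enum 'I_q) A i k * B k j) _) _ _.
- move=> i j; apply: spec_sumM => k _; exact: spec_mul.
- by move=> _ ->; apply/matrixP => i j; rewrite !mxE big_enum.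
- by rewrite size_enum_ord.
Qed.

Lemma spec_dotM p (u v : 'cV[R]_p) : spec (2 * p) (dotM cst u v) (eq^~ (ip u v)).
Proof.
rewrite /dotM; apply: spec_weaken (spec_sumM (F := fun k => u k ord0 * v k ord0) _) _ _.
- move=> k _; exact: spec_mul.
- by move=> _ ->; rewrite ipE big_enum.
- by rewrite size_enum_ord.
Qed.

Lemma spec_nonzero_cols p q (A : 'M[R]_(p, q)) (T : {set 'I_q}) :
  spec ((2 * p + 1) * q) (nonzero_cols cst A T)
    (eq^~ [set j in T | col j A != 0]).
Proof.
rewrite /nonzero_cols.
apply: spec_weaken (spec_bind (spec_tabulate_fun (F := fun j => 0 < ip (col j A) (col j A)) _ _)
  (P' := eq^~ [set j in T | col j A != 0]) (c' := 0) _) _ _ => //.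
- move=> j _; apply: spec_bind (spec_dotM _ _) _ => _ ->; exact: spec_less.
- move=> b Hb; apply: spec_weaken (spec_ret _) _ _ => // _ ->; apply/setP => j; rewrite !inE.
  by case jT: (j \in T) => //=; rewrite Hb ?mem_enum // ip_gt0.
- by rewrite addn0 leq_mul2l -cardE -[X in (_ <= X)%N]card_ord max_card orbT.
Qed.

End ProgramLogic.

(** * Matrix inversion and orthonormal bases *)

Section Pivoting.
Variable R : realType.
Local Notation cst := (@real_cst R).

Definition pivot_mx p (M : 'M[R]_p) (k : 'I_p) : 'M[R]_p :=
  \matrix_(i, j)
    if i == k then if j == k then 1 / M k k else 0 - M k j / M k k
    else if j == k then M i k / M k k else M i j - M i k / M k k * M k j.

Lemma spec_pivot p (M : 'M[R]_p) (k : 'I_p) : M k k != 0 ->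
  spec (3 * (p * p)) (pivot cst M k) (eq^~ (pivot_mx M k)).
Proof.
move=> M0; apply: spec_build_mx => i j.
case: (i == k).
  case: (j == k); first exact: spec_weaken (spec_div _ M0) _ _.
  apply: (@spec_weaken _ 2); last by [].
    by apply: (@spec_bind _ 1 1 _ _ _ _ _ _ (spec_div _ M0)) => _ ->; exact: spec_sub.
  by [].
apply: (@spec_bind _ 1 2 _ _ _ _ _ _ (spec_div _ M0)) => _ ->.
case: (j == k); first exact: spec_weaken (spec_ret _ _) _ _.
by apply: (@spec_bind _ 1 1 _ _ _ _ _ _ (spec_mul _ _)) => _ ->; exact: spec_sub.
Qed.

(** For [w = M v], pivoting on [s] turns the pair [w], [v] into [swap s v w], [swap s w v]. *)
Definition swap p (s : seq 'I_p) (v w : 'cV[R]_p) : 'cV[R]_p :=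
  \col_i if i \in s then v i ord0 else w i ord0.

Lemma swapK p (s : seq 'I_p) v w : swap s (swap s w v) (swap s v w) = w.
Proof. by apply/colP => i; rewrite !mxE; case: (i \in s). Qed.

Lemma ip_swap p (s : seq 'I_p) v w : ip (swap s v w) (swap s w v) = ip v w.
Proof.
by rewrite !ipE; apply: eq_bigr => i _; rewrite !mxE; case: ifP => // _; rewrite mulrC.
Qed.

Lemma swap_rcons p (s : seq 'I_p) k v w : k \notin s ->
  swap (rcons s k) v w = swap [:: k] (swap s w v) (swap s v w).
Proof.
move=> ks; apply/colP => i; rewrite !mxE mem_rcons !inE.
by case: eqP => [->|] //=; rewrite (negPf ks).
Qed.

(** Solve the [k]-th equation for the [k]-th entry of [v] and substitute it into the others; [S i]
    collects the terms that the exchange leaves alone. *)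
Lemma pivot_mxP p (N : 'M[R]_p) k v w : N k k != 0 ->
  w = N *m v <-> swap [:: k] v w = pivot_mx N k *m swap [:: k] w v.
Proof.
move=> N0; pose S i := \sum_(j | j != k) N i j * v j ord0.
have E1 i : (N *m v) i ord0 = N i k * v k ord0 + S i by rewrite mxE (bigD1 k).
have E2 i : (pivot_mx N k *m swap [:: k] w v) i ord0 =
    if i == k then (w k ord0 - S k) / N k k
    else N i k / N k k * w k ord0 + S i - N i k / N k k * S k.
  rewrite mxE (bigD1 k) //= !mxE inE eqxx; case: eqP => [->|ik].
    rewrite mulrBl; congr (_ + _); first by ring.
    rewrite mulrC -mulrN mulrC /S mulNr mulr_suml -sumrN; apply: eq_bigr => j jk.
    by rewrite !mxE inE (negPf jk) eqxx; field.
  rewrite -addrA; congr (_ + _); rewrite /S mulr_sumr -sumrB; apply: eq_bigr => j jk.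
  by rewrite !mxE inE (negPf jk); case: eqP ik => // _ _; ring.
split=> [e|e].
  apply/colP => i; rewrite E2 mxE inE e !E1; case: eqP => [->|_]; by field.
apply/colP => i; rewrite E1.
have ek : v k ord0 = (w k ord0 - S k) / N k k.
  by have := congr1 (fun x : 'cV_p => x k ord0) e; rewrite E2 mxE inE eqxx.
have [->|ik] := eqVneq i k; first by rewrite ek; field.
have := congr1 (fun x : 'cV_p => x i ord0) e; rewrite E2 mxE inE (negPf ik) ek => ->.
by field.
Qed.

Lemma spec_inverse p (M : 'M[R]_p) : sym_posdef M ->
  spec (3 * (p * p) * p) (inverse cst M) (fun Q => M *m Q = 1%:M).
Proof.
move=> pM; rewrite /inverse.
(* [N] expresses the vector with coordinates [v_i] ([i] in [s1]) and [w_i] (otherwise) by the complementary one. *)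
pose J s1 (N : 'M[R]_p) :=
  forall v w, w = M *m v <-> swap s1 v w = N *m swap s1 w v.
suff HJ : spec (3 * (p * p) * size (enum 'I_p)) (foldM (pivot cst (p:=p)) (enum 'I_p) M)
    (J (enum 'I_p)).
  apply: spec_weaken HJ _ _; last by rewrite size_enum_ord.
  move=> N HN; apply: mulmx1C.
  suff e j : col j (N *m M) = col j 1%:M.
    apply/matrixP => i j; have := congr1 (fun x : 'cV_p => x i ord0) (e j).
    by rewrite [LHS]mxE [RHS]mxE.
  rewrite !colE mul1mx -mulmxA.
  have := (HN (delta_mx j ord0) (col j M)).1; rewrite -colE => /(_ erefl).
  have sw (x y : 'cV[R]_p) : swap (enum 'I_p) x y = x.
    by apply/colP => i; rewrite mxE mem_enum.
  by rewrite !sw => <-.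
apply: spec_foldM => [N k s1 s2 es HN|]; last first.
  move=> v w; have sw (x y : 'cV[R]_p) : swap [::] x y = y by apply/colP => i; rewrite mxE.
  by rewrite !sw.
have ks : k \notin s1.
  have := enum_uniq 'I_p; rewrite es cat_uniq /= => /and3P [_ /norP [+ _] _].
  by [].
(* The pivot is a value of the quadratic form of [M]: take [w_i = 0] on [s1], [v_k = 1] and [v_i = 0] elsewhere. *)
have Nk : 0 < N k k.
  pose v' : 'cV[R]_p := delta_mx k ord0; pose w' := N *m v'.
  have Mv : swap s1 v' w' = M *m swap s1 w' v'.
    by apply/HN; rewrite !swapK.
  have v0 : swap s1 w' v' != 0.
    apply/eqP => /colP/(_ k); rewrite !mxE (negPf ks) !eqxx => /eqP.
    by rewrite oner_eq0.
  have := posdef_gt0 pM v0; rewrite -Mv ip_swap.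
  by rewrite /v' ip_delta /w' -colE mxE.
apply: spec_weaken (spec_pivot _) _ _; rewrite ?gt_eqF // => _ -> v w.
rewrite !swap_rcons //.
by apply: iff_trans (HN v w) _; apply: pivot_mxP; rewrite gt_eqF.
Qed.

End Pivoting.

(** * Householder bases of a hyperplane *)

Section Householder.
Variable R : realType.
Local Notation cst := (@real_cst R).

Lemma spec_householder p (a : 'cV[R]_p) : a != 0 ->
  spec (4 * (p * p) + 4 * p + 3) (householder cst a)
    (fun W => W^T *m W = 1%:M /\ a^T *m W = 0).
Proof.
case: p a => [|p] a a0; first by case/eqP: a0; apply/colP => -[].
rewrite /householder.
pose na := Num.sqrt (ip a a).
(* As [c] never has the sign opposite to the first entry of [a], no cancellation can make [v]
   zero. *)
pose c := if a ord0 ord0 < 0 then - na else na.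
pose v : 'cV[R]_p.+1 := \col_i if i == ord0 then a ord0 ord0 + c else a i ord0.
have va : v = a + c *: delta_mx ord0 ord0.
  by apply/colP => i; rewrite !mxE andbT; case: eqP => [->|_]; rewrite ?mulr1 // mulr0 addr0.
have na0 : 0 <= na by rewrite sqrtr_ge0.
have ca : 0 <= c * a ord0 ord0.
  by rewrite /c; case: ifP => [/ltW h|/negbT]; [rewrite mulNr oppr_ge0 mulr_ge0_le0|
    rewrite -leNgt => h; rewrite mulr_ge0].
have cc : c ^+ 2 = ip a a.
  have naa : na ^+ 2 = ip a a by rewrite sqr_sqrtr // ip_ge0.
  by rewrite /c; case: ifP; rewrite ?sqrrN.
have ipva : ip v a = ip a a + c * a ord0 ord0.
  by rewrite va ipDl ipZl [ip (delta_mx _ _) _]ipC ip_delta.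
(* By this identity the reflection along [v] sends [a] to [a - v], a multiple of the first unit
   vector, so its other columns are orthogonal to [a]. *)
have ipvv : ip v v = 2 * ip v a.
  have v00 : v ord0 ord0 = a ord0 ord0 + c by rewrite mxE eqxx.
  by rewrite {2}va ipDr ipZr ip_delta v00 ipva mulrDr -expr2 cc; ring.
have d0 : 0 < ip v v by rewrite ipvv mulr_gt0 // ipva ltr_pwDl // ip_gt0.
move=> t.
apply: (wp_bind_spec (spec_dotM _ _)) => _ t1 -> le1.
apply: (wp_bind_spec (spec_sqrt (ip_ge0 _))) => _ t2 -> le2.
apply: (wp_bind_spec (spec_less _ _)) => _ t3 -> le3.
have s4 : spec 1 (if a ord0 ord0 < real_cst R 0 then Defs.sub (a ord0 ord0) na
    else Defs.add (a ord0 ord0) na) (eq^~ (a ord0 ord0 + c)).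
  by rewrite /c; case: ifP => _; [exact: spec_sub | exact: spec_add].
apply: (wp_bind_spec s4) => _ t4 -> le4; rewrite -/v.
apply: (wp_bind_spec (spec_dotM _ _)) => _ t5 -> le5.
pose W : 'M[R]_(p.+1, p) := \matrix_(i, j) ((if i == lift ord0 j then 1 else 0) -
    (v i ord0 * v (lift ord0 j) ord0 + v i ord0 * v (lift ord0 j) ord0) / ip v v).
have s6 : spec (4 * (p.+1 * p)) (build_mx cst (fun (i : 'I_p.+1) (j : 'I_p) =>
        let! u := Defs.mul (v i ord0) (v (lift ord0 j) ord0) in
        let! u2 := Defs.add u u in
        let! w := Defs.div u2 (ip v v) in
        Defs.sub (if i == lift ord0 j then cst 1 else cst 0) w)) (eq^~ W).
  apply: spec_build_mx => i j.
  apply: (@spec_bind _ 1 3 _ _ _ _ _ _ (spec_mul _ _)) => _ ->.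
  apply: (@spec_bind _ 1 2 _ _ _ _ _ _ (spec_add _ _)) => _ ->.
  apply: (@spec_bind _ 1 1 _ _ _ _ _ _ (spec_div _ _)) => [|_ ->]; first by rewrite gt_eqF.
  exact: spec_sub.
apply: (wp_spec s6) => _ t6 -> le6; split; last by nia.
have colW j : col j W = delta_mx (lift ord0 j) ord0 -
    (2 * v (lift ord0 j) ord0 / ip v v) *: v.
  apply/colP => i; rewrite !mxE andbT; congr (_ - _); first by case: eqP.
  by ring.
split; apply/matrixP => i j.
  rewrite entry_ip_col !colW [RHS]mxE ipDl !ipDr !ipNl !ipNr !ipZl !ipZr !ip_delta.
  rewrite [ip (delta_mx _ _) v]ipC ip_delta mxE (inj_eq lift_inj) andbT eq_sym.
  by field; rewrite gt_eqF.
rewrite ord1 [RHS]mxE.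
have -> : (a^T *m W) ord0 j = ip a (col j W).
  by rewrite mxE ipE; apply: eq_bigr => k _; rewrite !mxE.
have vl : v (lift ord0 j) ord0 = a (lift ord0 j) ord0 by rewrite mxE.
rewrite colW ipDr ipNr ipZr ip_delta vl [ip a v]ipC.
have -> : 2 * a (lift ord0 j) ord0 / ip v v * ip v a = a (lift ord0 j) ord0 * (2 * ip v a) / ip v v by ring.
by rewrite -ipvv mulfK ?subrr // gt_eqF.
Qed.

(** Every permitted choice satisfies these two relations; that the columns then span the complement
    is recovered by [orth_complement_proj]. *)
Lemma spec_any_basis p (a : 'cV[R]_p) : a != 0 ->
  spec (4 * (p * p) + 4 * p + 3) (any_basis a)
    (fun W => W^T *m W = 1%:M /\ a^T *m W = 0).
Proof.
move=> a0; rewrite -[X in spec X]addn0; apply: spec_bind (spec_householder a0) _ => W0 HW.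
move=> t; split=> [|W HW']; first by exists W0; left.
by rewrite addn0; split=> //; case: HW' => [-> //|[]].
Qed.

End Householder.

(** * Independent columns and the greedy computation of [theta] *)

Section Independence.
Variable R : realType.
Variables m n : nat.
Variable A : 'M[R]_(m, n).
Implicit Types (B O : {set 'I_n}) (c : 'cV[R]_n).

(** Coefficient vectors stay indexed by all columns, so index sets can grow or be exchanged without
    a change of type; [indep_rankP] leads back to the submatrices in [DeltaA]. *)
Definition supported B c := forall j, j \notin B -> c j ord0 = 0.

Definition indep B := forall c, supported B c -> A *m c = 0 -> c = 0.

Definition in_span B (v : 'cV[R]_m) := exists2 c, supported B c & v = A *m c.

Lemma supportedD B c c' : supported B c -> supported B c' -> supported B (c + c').
Proof. by move=> h h' j jB; rewrite mxE h // h' // addr0. Qed.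

Lemma supportedZ B a c : supported B c -> supported B (a *: c).
Proof. by move=> h j jB; rewrite mxE h // mulr0. Qed.

Lemma supportedS B O c : B \subset O -> supported B c -> supported O c.
Proof. by move=> /subsetP BO h j jO; apply: h; apply: contra jO => /BO. Qed.

Lemma supported_delta B j : j \in B -> supported B (delta_mx j ord0).
Proof. by move=> jB i iB; rewrite mxE andbT; case: eqP iB => // ->; rewrite jB. Qed.

Lemma supported0 B : supported B 0.
Proof. by move=> j _; rewrite mxE. Qed.

Lemma mulmx_sum_cols p q (M : 'M[R]_(p, q)) (c : 'cV[R]_q) :
  M *m c = \sum_j c j ord0 *: col j M.
Proof.
apply/colP => i; rewrite mxE summxE; apply: eq_bigr => j _.
by rewrite !mxE mulrC.
Qed.

Lemma mulmx_supported B c : supported B c -> A *m c = \sum_(j in B) c j ord0 *: col j A.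
Proof.
move=> h; rewrite mulmx_sum_cols (bigID (mem B)) /= [X in _ + X]big1 ?addr0 // => j jB.
by rewrite h // scale0r.
Qed.

Lemma cols_mulmx B c : supported B c ->
  cols A B *m (\col_i c (enum_val i) ord0) = A *m c.
Proof.
move=> h; rewrite (mulmx_supported h) // big_enum_val mulmx_sum_cols.
by apply: eq_bigr => i _; rewrite mxE; congr (_ *: _); apply/colP => k; rewrite !mxE.
Qed.

Definition extend B (v : 'cV[R]_#|B|) : 'cV[R]_n :=
  \sum_i v i ord0 *: delta_mx (enum_val i) ord0.

Lemma extend_val B v i : extend v (@enum_val _ (mem B) i) ord0 = v i ord0.
Proof.
rewrite /extend summxE (bigD1 i) //= !mxE !eqxx mulr1 big1 ?addr0 // => j ji.
by rewrite !mxE (inj_eq enum_val_inj) eq_sym (negPf ji) mulr0.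
Qed.

Lemma supported_extend B (v : 'cV[R]_#|B|) : supported B (extend v).
Proof.
move=> j jB; rewrite /extend summxE big1 // => i _; rewrite !mxE andbT.
case: eqP jB => [->|_ _]; last by rewrite mulr0.
by rewrite enum_valP.
Qed.

Lemma mulmx_extend B (v : 'cV[R]_#|B|) : A *m extend v = cols A B *m v.
Proof.
rewrite -(cols_mulmx (supported_extend v)).
by congr (_ *m _); apply/colP => i; rewrite mxE extend_val.
Qed.

Lemma indepP B : indep B <-> forall v : 'cV[R]_#|B|, cols A B *m v = 0 -> v = 0.
Proof.
split=> [iB v v0|iB c sc Ac].
  apply/colP => i; rewrite -extend_val mxE.
  by rewrite (iB (extend v)) ?mxE ?mulmx_extend //; exact: supported_extend.
have /colP e := iB (\col_i c (enum_val i) ord0) (etrans (cols_mulmx sc) Ac).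
apply/colP => j; have [jB|/sc ->] := boolP (j \in B); last by rewrite mxE.
by have := e (enum_rank_in jB j); rewrite !mxE enum_rankK_in.
Qed.

Lemma indep_rankP B : reflect (indep B) (#|B| == \rank (cols A B)).
Proof.
rewrite -mxrank_tr eq_sym -/(row_free _); apply: (iffP idP) => [fr|/indepP iB].
  apply/indepP => v v0; apply: trmx_inj; rewrite trmx0.
  by apply: (row_free_inj fr); rewrite /= mul0mx -trmx_mul v0 trmx0.
rewrite -kermx_eq0; apply/eqP/row_matrixP => i; rewrite row0.
apply: trmx_inj; rewrite trmx0; apply: iB; apply: trmx_inj.
by rewrite trmx_mul trmxK trmx0 -row_mul mulmx_ker row0.
Qed.

Lemma indep_card B : indep B -> (#|B| <= m)%N.
Proof. by move=> /indep_rankP /eqP ->; exact: rank_leq_row. Qed.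

Lemma indep0 : indep finset.set0.
Proof. by move=> c s0 _; apply/colP => j; rewrite mxE s0 ?inE. Qed.

Lemma indepS B O : B \subset O -> indep O -> indep B.
Proof. by move=> BO iO c /(supportedS BO); apply: iO. Qed.

Lemma indep_setU1 O k : indep O -> ~ in_span O (col k A) -> indep (k |: O).
Proof.
move=> iO nk c sc Ac.
have [ck|ck] := eqVneq (c k ord0) 0.
  apply: iO => // j jO; have [->//|jk] := eqVneq j k.
  by apply: sc; rewrite !inE (negPf jk).
case: nk; exists (delta_mx k ord0 - (c k ord0)^-1 *: c).
  move=> j jO; rewrite !mxE andbT; have [->|jk] := eqVneq j k.
    by rewrite mulVf // subrr.
  have -> : c j ord0 = 0 by apply: sc; rewrite !inE negb_or jk.
  by rewrite mulr0 subr0.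
by rewrite mulmxBr -scalemxAr Ac scaler0 subr0 colE.
Qed.

Lemma indep_notin_span B O j :
  indep O -> B \subset O -> j \in O -> j \notin B -> ~ in_span B (col j A).
Proof.
move=> iO BO jO jB [c sc e].
have := iO (c - delta_mx j ord0).
have -> : A *m (c - delta_mx j ord0) = 0 by rewrite mulmxBr -e -colE subrr.
have s : supported O (c - delta_mx j ord0).
  apply: supportedD; first exact: supportedS sc.
  by rewrite -scaleN1r; apply: supportedZ; exact: supported_delta.
move=> /(_ s erefl) /colP /(_ j); rewrite !mxE !eqxx sc // sub0r => /eqP.
by rewrite oppr_eq0 oner_eq0.
Qed.

Lemma DeltaA_ge B : indep B -> \prod_(j in B) norm2 (col j A) <= DeltaA A.
Proof.
move=> /indep_rankP iB.
exact: (le_bigmax_cond _ (fun B : {set 'I_n} => \prod_(j in B) norm2 (col j A))).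
Qed.

Lemma DeltaA_le x : 0 <= x ->
  (forall B, indep B -> \prod_(j in B) norm2 (col j A) <= x) -> DeltaA A <= x.
Proof. by move=> x0 H; apply: bigmax_le => // B /indep_rankP; exact: H. Qed.

Lemma norm2E p (v : 'cV[R]_p) : norm2 v = Num.sqrt (ip v v).
Proof. by rewrite /norm2 ipE; congr Num.sqrt; apply: eq_bigr => i _; rewrite expr2. Qed.

Lemma norm2_sqr p (v : 'cV[R]_p) : norm2 v ^+ 2 = ip v v.
Proof. by rewrite norm2E sqr_sqrtr // ip_ge0. Qed.

Lemma prod_norm2_sqr B :
  (\prod_(j in B) norm2 (col j A)) ^+ 2 = \prod_(j in B) ip (col j A) (col j A).
Proof. by rewrite -prodrXl; apply: eq_bigr => j _; rewrite norm2_sqr. Qed.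

End Independence.

(** * Greedy choice of a column basis and the exchange argument *)

Section Greedy.
Variable R : realType.
Local Notation cst := (@real_cst R).

Definition reduce p q (D : 'M[R]_(p, q)) k : 'M[R]_(p, q) :=
  \matrix_(i, j) (D i j - ip (col k D) (col j D) / ip (col k D) (col k D) * D i k).

Lemma spec_greedy_step p q (sq : 'I_q -> R) (D : 'M[R]_(p, q)) d :
  spec (6 * (p * q) + 3 * q + 1) (greedy_step cst sq (D, d))
    (fun z => ((forall j, col j D = 0) /\ z = (D, d)) \/
       exists k, [/\ col k D != 0, forall j, col j D != 0 -> sq j <= sq k
                   & z = (reduce D k, d * sq k)]).
Proof.
move=> t; rewrite /greedy_step.
have ss : size (enum 'I_q) = q by rewrite size_enum_ord.
apply: (wp_bind_spec (spec_tabulate_fun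
  (F := fun j => ip (col j D) (col j D)) (c := 2 * p) _ _)) => [j _|rr t1 Hrr le1].
  exact: spec_dotM.
rewrite ss in le1.
apply: (wp_bind_spec (spec_tabulate_fun
  (F := fun j => col j D != 0) (c := 1) _ _)) => [j _|nz t2 Hnz le2].
  rewrite Hrr ?mem_enum // -ip_gt0; exact: spec_less.
rewrite ss in le2.
pose J (s1 : seq 'I_q) (best : option 'I_q) := match best with
  | None => forall j, j \in s1 -> col j D = 0
  | Some b => col b D != 0 /\ forall j, j \in s1 -> col j D != 0 -> sq j <= sq b end.
apply: (wp_bind_spec (spec_foldM (c := 1) (J := J) _ _)) => //; last first.
  move=> best t3 Jb le3; rewrite ss in le3.
  case: best Jb => [k|] Jb; last first.
    split; last by lia.
    by left; split=> // j; apply: Jb; rewrite mem_enum.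
  have [k0 kmax] := Jb.
  apply: (wp_bind_spec (spec_mul _ _)) => _ t4 -> le4.
  apply: (wp_bind_spec (spec_tabulate_fun
    (F := fun j => ip (col k D) (col j D) / ip (col k D) (col k D)) (c := 2 * p + 1) _ _)) => [j _|c t5 Hc le5].
    apply: spec_bind (spec_dotM _ _) _ => _ ->; rewrite Hrr ?mem_enum //.
    by apply: spec_div; rewrite ip_eq0.
  rewrite ss in le5.
  apply: (wp_bind_spec (c := 2 * (p * q)) (P := eq^~ (reduce D k)) (p := build_mx _ _)) => [|_ t6 -> le6].
    apply: spec_build_mx => i j.
    apply: (@spec_bind _ 1 1 _ _ _ _ _ _ (spec_mul _ _)) => _ ->.
    by rewrite Hc ?mem_enum //; exact: spec_sub.
  split; last by nia.
  by right; exists k; split=> // j; apply: kmax; rewrite mem_enum.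
move=> best j s1 s2 es Jb; rewrite Hnz ?mem_enum //.
case: (eqVneq (col j D) 0) => [j0|j0] /=.
  apply: spec_weaken (spec_ret _ _) _ _ => // _ ->.
  case: best Jb => [b [b0 bm]|bm] /=; first split=> // i.
    by rewrite mem_rcons inE => /predU1P [->|/bm//]; rewrite j0 eqxx.
  by move=> i; rewrite mem_rcons inE => /predU1P [->|/bm].
case: best Jb => [b [b0 bm]|bm].
  rewrite -[1%N]/(1 + 0)%N; apply: spec_bind (spec_less _ _) _ => _ ->.
  apply: spec_weaken (spec_ret _ _) _ _ => // _ ->.
  case: ltP => lt /=; split=> // i; rewrite mem_rcons inE => /predU1P [->//|].
    by move=> /bm h /h /le_trans; apply; exact: ltW.
  exact: bm.
apply: spec_weaken (spec_ret _ _) _ _ => // _ -> /=; split=> // i.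
by rewrite mem_rcons inE => /predU1P [->//|/bm ->]; rewrite eqxx.
Qed.

Variables (m n : nat) (A : 'M[R]_(m, n)).
Hypothesis A1 : forall j, col j A != 0 -> 1 <= ip (col j A) (col j A).
Local Notation sq j := (ip (col j A) (col j A)).

(* [B] is the set of columns chosen so far; by the exchange property it stays contained in an independent set that is at least as good as any given one. *)
Definition greedy_inv (k : nat) (D : 'M[R]_(m, n)) (d : R) : Prop :=
  exists B : {set 'I_n},
    [/\ #|B| = k \/ (forall j, col j D = 0),
        forall j, in_span A B (col j A - col j D),
        forall j b, b \in B -> ip (col b A) (col j D) = 0,
        d = \prod_(j in B) sq j
      & forall I, indep A I -> exists O, [/\ indep A O, B \subset O &
          \prod_(j in I) sq j <= \prod_(j in O) sq j]].

Lemma greedy_inv0 : greedy_inv 0 A 1.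
Proof.
exists finset.set0; split; rewrite ?cards0 ?big_set0 //; first by left.
- by move=> j; exists 0; [exact: supported0 | rewrite subrr mulmx0].
- by move=> j b; rewrite inE.
- by move=> I iI; exists I; rewrite sub0set.
Qed.

(** A set [O] containing [B] is adapted to [j]: nothing changes if [j] is in [O]; if [j] is
    independent of [O] it is added, and [A1] keeps the product from dropping; otherwise [j] replaces
    some [i] of [O] outside [B]. Such an [i] has a nonzero projected column, so the greedy choice
    gives [sq i <= sq j]. *)
Lemma greedy_inv_step k D d j :
  greedy_inv k D d -> col j D != 0 -> (forall i, col i D != 0 -> sq i <= sq j) ->
  greedy_inv k.+1 (reduce D j) (d * sq j).
Proof.
move=> [B [cB spB orB dB exB]] j0 jmax.
have orB' (c : 'cV[R]_n) i : supported B c -> ip (A *m c) (col i D) = 0.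
  move=> sc; rewrite (mulmx_supported A sc) ip_suml big1 // => b bB.
  by rewrite ipZl orB // mulr0.
have nsp i : col i D != 0 -> ~ in_span A B (col i A).
  move=> i0 [c sc e]; have [c' sc' e'] := spB i.
  have Di : col i D = A *m (c - c') by rewrite mulmxBr -e -e' opprB addrC subrK.
  have s : supported B (c - c').
    by apply: supportedD => //; rewrite -scaleN1r; exact: supportedZ.
  have := orB' _ i s; rewrite -Di => /eqP.
  by rewrite ip_eq0 (negPf i0).
have jB : j \notin B.
  apply/negP => jB; apply: (nsp j j0); exists (delta_mx j ord0); last by rewrite colE.
  exact: supported_delta.
have sj : 1 <= sq j.
  apply: A1; apply/eqP => e; apply: (nsp j j0); exists 0; first exact: supported0.
  by rewrite mulmx0.
have colr i : col i (reduce D j) = col i D -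
    (ip (col j D) (col i D) / ip (col j D) (col j D)) *: col j D.
  by apply/colP => l; rewrite !mxE.
exists (j |: B); split.
- left; case: cB => [<-|/(_ j) e]; first by rewrite cardsU1 jB.
  by rewrite e eqxx in j0.
- move=> i; have [c sc e] := spB i; have [c' sc' e'] := spB j.
  set r := ip (col j D) (col i D) / ip (col j D) (col j D).
  exists (c + r *: (delta_mx j ord0 - c')).
    apply: supportedD; first by apply: supportedS sc; exact: subsetUr.
    apply: supportedZ; apply: supportedD; first by apply: supported_delta; rewrite !inE eqxx.
    rewrite -scaleN1r; apply: supportedZ; apply: supportedS sc'; exact: subsetUr.
  rewrite mulmxDr -scalemxAr mulmxBr -e -e' -colE colr -/r opprB addrA addrAC.
  by rewrite opprB addrCA subrr addr0.
- move=> i b; rewrite !inE colr ipDr ipNr ipZr => /predU1P [->|bB]; last first.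
    by rewrite !orB // mulr0 subrr.
  have [c' sc' e'] := spB j.
  have aj : col j A = A *m c' + col j D by rewrite -e' subrK.
  by rewrite aj !ipDl !orB' // !add0r mulfVK ?subrr // ip_eq0.
- by rewrite big_setU1 //= dB mulrC.
move=> I /exB [O [iO BO le]].
have [jO|jO] := boolP (j \in O).
  by exists O; split=> //; apply/subsetP => i; rewrite !inE => /predU1P [->|/(subsetP BO)].
have [spO|spO] := EM (in_span A O (col j A)); last first.
  exists (j |: O); split; [exact: indep_setU1 | exact: setUS | ].
  apply: le_trans le _; rewrite big_setU1 //= ler_peMl // prodr_ge0 // => i _.
  exact: ip_ge0.
have [c sc e] := spO.
(* If all coefficients of [j] outside [B] vanished, [j] would lie in the span of [B], against its
   nonzero projection. *)
have [i [iO' iB ci]] : exists i, [/\ i \in O, i \notin B & c i ord0 != 0].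
  apply: contrapT => nex; apply: (nsp j j0); exists c => // i iB.
  apply/eqP; apply: contrapT => /negP ci; apply: nex; exists i; split=> //.
  by apply: contraNT ci => /sc ->.
exists (j |: (O :\ i)); split.
- apply: indep_setU1; first by apply: indepS iO; exact: subD1set.
  move=> [c2 sc2 e2]; have s : supported O (c - c2).
    apply: supportedD => //; rewrite -scaleN1r; apply: supportedZ.
    by apply: supportedS sc2; exact: subD1set.
  have := iO _ s; rewrite mulmxBr -e -e2 subrr => /(_ erefl)/colP/(_ i).
  by rewrite !mxE sc2 ?subr0 ?inE ?eqxx // => /eqP; rewrite (negPf ci).
- apply: setUS; apply/subsetP => l lB; rewrite !inE (subsetP BO) // andbT.
  by apply: contraNneq iB => <-.
apply: le_trans le _; rewrite (big_setD1 i) //= big_setU1 /=; last first.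
  by rewrite !inE negb_and jO orbT.
apply: ler_wpM2r; first by apply: prodr_ge0 => l _; exact: ip_ge0.
apply: jmax; apply/eqP => Di; apply: (indep_notin_span iO BO iO' iB).
by have := spB i; rewrite Di subr0.
Qed.

(** After [m] rounds [B] has [m] elements or all projections vanish; either way no independent set
    properly contains [B], so the set [O] supplied by the invariant is [B] itself. *)
Lemma greedy_inv_end D d : greedy_inv m D d -> d = DeltaA A ^+ 2 /\ 1 <= DeltaA A.
Proof.
move=> [B [cB spB orB dB exB]].
have BO O : indep A O -> B \subset O -> O = B.
  move=> iO sBO; case: cB => [cB|D0].
    by apply/esym/eqP; rewrite eqEcard sBO cB (indep_card iO).
  apply/eqP; rewrite eqEsubset sBO andbT; apply/subsetP => i iO'.
  apply/negPn/negP => iB; apply: (indep_notin_span iO sBO iO' iB).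
  by have := spB i; rewrite D0 subr0.
have iB : indep A B.
  by have [O [iO sBO _]] := exB _ (@indep0 _ _ _ A); rewrite -(BO _ iO sBO).
have mx I : indep A I -> \prod_(j in I) sq j <= \prod_(j in B) sq j.
  by move=> /exB [O [iO sBO]]; rewrite (BO _ iO sBO).
have n0 (I : {set 'I_n}) : 0 <= \prod_(j in I) norm2 (col j A).
  by apply: prodr_ge0 => j _; exact: sqrtr_ge0.
have DE : DeltaA A = \prod_(j in B) norm2 (col j A).
  apply/eqP; rewrite eq_le DeltaA_ge // andbT; apply: DeltaA_le => // I iI.
  by rewrite -(ler_pXn2r (n := 2)) ?nnegrE // !prod_norm2_sqr mx.
split; first by rewrite DE prod_norm2_sqr.
have := DeltaA_ge (@indep0 _ _ _ A); by rewrite big_set0.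
Qed.

Lemma spec_compute_theta : (0 < m)%N ->
  spec (2 * (m * n) + (6 * (m * n) + 3 * n + 1) * m + 3) (compute_theta cst A)
    (fun theta => theta = thetaA A /\ 1 <= DeltaA A).
Proof.
move=> m0 t; rewrite /compute_theta.
have ss : size (enum 'I_n) = n by rewrite size_enum_ord.
apply: (wp_bind_spec (spec_tabulate_fun
  (F := fun j => sq j) (c := 2 * m) _ _)) => [j _|s t1 Hs le1].
  exact: spec_dotM.
rewrite ss in le1.
apply: (wp_bind_spec (spec_foldM (c := 6 * (m * n) + 3 * n + 1)
   (J := fun s1 z => greedy_inv (size s1) z.1 z.2) _ _)); last 1 first.
- move=> [D d] t2; rewrite size_enum_ord => /greedy_inv_end [dE D1] le2.
  rewrite -[(D, d).2]/d in dE *; rewrite dE.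
  apply: (wp_bind_spec (spec_mul _ _)) => _ t3 -> le3.
  apply: (wp_bind_spec (spec_mul _ _)) => _ t4 -> le4.
  have nz : real_cst R m * real_cst R m * DeltaA A ^+ 2 != 0.
    have mR : real_cst R m != 0 by rewrite /real_cst pnatr_eq0 -lt0n.
    by apply: mulf_neq0; [exact: mulf_neq0 | rewrite expf_neq0 // gt_eqF // (lt_le_trans ltr01)].
  apply: (wp_spec (spec_div _ nz)) => _ t5 -> le5; split; last by lia.
  by split=> //; rewrite /thetaA /real_cst div1r expr2.
- move=> [D d] i s1 s2 _ /= inv; rewrite size_rcons.
  apply: spec_weaken (spec_greedy_step _ _ _) _ _ => // z.
  case=> [[D0 ->]|[k [k0 kmax ->]]] /=.
    (* Once no nonzero column is left, [B] stops growing and the second alternative on its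
       cardinality takes over. *)
    by have [B [_ ? ? ? ?]] := inv; exists B; split=> //; right.
  rewrite Hs ?mem_enum //; apply: greedy_inv_step => // j /kmax.
  by rewrite !Hs ?mem_enum.
- exact: greedy_inv0.
Qed.

End Greedy.

(** * The width of the solution cone *)

Section Width.
Variable R : realType.

Lemma is_solutionP m n (A : 'M[R]_(m, n)) y :
  is_solution A y <-> forall j, 0 <= ip (col j A) y.
Proof. by split=> h j; [rewrite ip_col | rewrite -ip_col]. Qed.

Lemma full_rank_orth m n (A : 'M[R]_(m, n)) d : \rank A = m ->
  (forall j, ip (col j A) d = 0) -> d = 0.
Proof.
move=> rk d0; have fr : row_free A by rewrite /row_free rk.
apply: trmx_inj; rewrite trmx0; apply: (row_free_inj fr); rewrite /= mul0mx.
apply: trmx_inj; rewrite trmx_mul trmxK trmx0; apply/colP => j.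
by rewrite -ip_col d0 mxE.
Qed.

(* Following a direction along which the constraints that are already tight stay tight, until another one becomes tight. *)
Lemma vertex_solution m n (A : 'M[R]_(m, n)) k y0 : \rank A = m ->
  is_solution A y0 -> ip (col k A) y0 = 1 ->
  exists y, [/\ is_solution A y, ip (col k A) y = 1 &
    forall d, (forall j, ip (col j A) y = 0 -> ip (col j A) d = 0) ->
      ip (col k A) d = 0 -> d = 0].
Proof.
move=> rk.
have [N le] := ubnP #|[set j | ip (col j A) y0 != 0]|.
elim: N y0 le => // N IH y ltN sol k1.
have [opt|nopt] := EM (forall d, (forall j, ip (col j A) y = 0 -> ip (col j A) d = 0) ->
      ip (col k A) d = 0 -> d = 0); first by exists y.
have [d [d_tight dk d0]] : exists d, [/\ forall j, ip (col j A) y = 0 -> ip (col j A) d = 0,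
    ip (col k A) d = 0 & d != 0].
  apply: contrapT => nex; apply: nopt => d h1 h2; apply: contrapT => /eqP d0.
  by apply: nex; exists d.
(* By full rank some column has a nonzero product with [d]; after a change of sign that constraint
   decreases along the direction. *)
have [e [e_tight ek [j0 ej0]]] : exists e, [/\ forall j, ip (col j A) y = 0 -> ip (col j A) e = 0,
    ip (col k A) e = 0 & exists j, ip (col j A) e < 0].
  have [j dj] : exists j, ip (col j A) d != 0.
    apply: contrapT => nex; case/eqP: d0; apply: (full_rank_orth rk) => j.
    by apply/eqP; apply: contrapT => /negP dj; apply: nex; exists j.
  case: (ltrgt0P (ip (col j A) d)) dj => // dj _.
    exists (- d); split; last by exists j; rewrite ipNr oppr_lt0.
      by move=> i /d_tight; rewrite ipNr => ->; rewrite oppr0.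
    by rewrite ipNr dk oppr0.
  by exists d; split=> //; exists j.
(* Ratio test: [j] is the first decreasing constraint to become tight, so the step [t] keeps all the
   others satisfied. *)
case: (@arg_minP _ _ _ j0 (fun j => ip (col j A) e < 0)
  (fun j => ip (col j A) y / - ip (col j A) e) ej0) => j ej jmin.
have /is_solutionP sy := sol.
set t := ip (col j A) y / - ip (col j A) e in jmin.
have t0 : 0 <= t by rewrite divr_ge0 ?oppr_ge0 // ltW.
have yj : ip (col j A) (y + t *: e) = 0.
  by rewrite ipDr ipZr /t; field; rewrite lt_eqF.
apply: (IH (y + t *: e)).
- rewrite -ltnS; apply: leq_trans _ ltN; rewrite ltnS; apply: proper_card.
  apply/properP; split.
    apply/subsetP => i; rewrite !inE ipDr ipZr; apply: contraNneq => yi.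
    by rewrite yi e_tight // mulr0 addr0.
  exists j; rewrite !inE ?yj ?eqxx //; apply/eqP => /e_tight e0.
  by rewrite e0 ltxx in ej.
- apply/is_solutionP => i; rewrite ipDr ipZr.
  have [ei|ei] := lerP 0 (ip (col i A) e); first by rewrite addr_ge0 // mulr_ge0.
  have := jmin i ei; rewrite ler_pdivlMr ?oppr_gt0 //.
  by rewrite mulrN -subr_ge0 opprK.
- by rewrite ipDr ipZr ek mulr0 addr0.
Qed.

(** Take a largest independent subset of [k |: T] containing [k]: a column of [T] outside its span
    could be added. *)
Lemma spanning_independent m n (A : 'M[R]_(m, n)) k (T : {set 'I_n}) : col k A != 0 ->
  exists B, [/\ indep A B, k \in B, B \subset k |: T &
    forall j, j \in T -> in_span A B (col j A)].
Proof.
move=> k0.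
pose P (B : {set 'I_n}) := [&& #|B| == \rank (cols A B), k \in B & B \subset k |: T].
have P0 : P [set k].
  apply/and3P; split; rewrite ?inE ?eqxx // ?sub1set ?inE ?eqxx //.
  apply/indep_rankP; rewrite -[[set k]]setU0; apply: indep_setU1; first exact: indep0.
  case=> c sc e; case/eqP: k0; rewrite e (_ : c = 0) ?mulmx0 //.
  by apply/colP => i; rewrite mxE sc ?inE.
case: (@arg_maxnP _ _ P (fun B => #|B|) P0) => B /and3P [/indep_rankP iB kB sB] Bmax.
exists B; split=> // j jT; apply: contrapT => nj.
have jB : j \notin B.
  by apply/negP => jB; apply: nj; exists (delta_mx j ord0); [exact: supported_delta | rewrite colE].
have := Bmax (j |: B); rewrite cardsU1 jB add1n => H.
suff /H : P (j |: B) by rewrite /= ltnn.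
apply/and3P; split.
- by apply/indep_rankP; exact: indep_setU1.
- by rewrite !inE kB orbT.
- by rewrite subUset sB andbT sub1set !inE jT orbT.
Qed.

(** [H k k * \det G] is the minor of [G] without row and column [k], which Hadamard's inequality
    bounds by the product of the other diagonal entries. *)
Lemma inv_diag_le p (G H : 'M[R]_p) k : sym_posdef G -> 1 <= \det G ->
  G *m H = 1%:M -> H k k * G k k <= \prod_i G i i.
Proof.
move=> pG dG GH; have [uG _] := mulmx1_unit GH.
have -> : H = invmx G by rewrite -[H]mul1mx -(mulVmx uG) -mulmxA GH mulmx1.
rewrite /invmx uG !mxE /cofactor -signr_odd addnn odd_double expr0 mul1r.
rewrite (bigD1_ord k) //= mulrC ler_pM2l ?posdef_diag //.
pose W : 'M[R]_(p, p.-1) := col' k 1%:M.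
have minorE : row' k (col' k G) = W^T *m (G *m W).
  have mulW q (X : 'M[R]_(q, p)) : X *m W = col' k X by rewrite mulmx_colsub mulmx1.
  by rewrite mulW; apply: trmx_inj; rewrite trmx_mul trmxK mulW tr_row'.
have pM : sym_posdef (row' k (col' k G)).
  rewrite minorE; apply: posdef_cong => // v Wv.
  have WW : W^T *m W = 1%:M.
    apply/matrixP => i j; rewrite entry_ip_col ipE (bigD1 (lift k i)) //= big1 => [|l li].
      by rewrite !mxE eqxx mul1r addr0 (inj_eq lift_inj).
    by rewrite !mxE (negPf li) mul0r.
  by rewrite -[v]mul1mx -WW -mulmxA Wv mulmx0.
have : \det (row' k (col' k G)) <= \prod_(i < p.-1) G (lift k i) (lift k i).
  by apply: le_trans (hadamard pM) _; rewrite le_eqVlt; apply/orP; left; apply/eqP;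
     apply: eq_bigr => i _; rewrite !mxE.
apply: le_trans; rewrite mulrC ler_pdivrMr ?(lt_le_trans ltr01) //.
by rewrite ler_peMr // ltW // det_posdef_gt0.
Qed.

Lemma det_int_ge1 p (G : 'M[int]_p) :
  sym_posdef (int_mx R G) -> 1 <= \det (int_mx R G).
Proof.
by move/det_posdef_gt0; rewrite det_map_mx /= ltr0z ler1z.
Qed.

Variables m n : nat.
Variable A0 : 'M[int]_(m, n).
Let A := int_mx R A0.
Hypothesis rkA : \rank A = m.

Lemma vertex_norm k y : ip (col k A) y = 1 ->
  (forall d, (forall j, ip (col j A) y = 0 -> ip (col j A) d = 0) ->
      ip (col k A) d = 0 -> d = 0) ->
  norm2 y * norm2 (col k A) <= DeltaA A.
Proof.
move=> k1 tight.
have k0 : col k A != 0 by apply: contra_eq_neq k1 => ->; rewrite ip0l eq_sym oner_neq0.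
have [B [iB kB sB spB]] := spanning_independent [set j | ip (col j A) y == 0] k0.
have D0 : 0 <= DeltaA A by apply: le_trans (DeltaA_ge iB); apply: prodr_ge0 => j _; exact: sqrtr_ge0.
rewrite -(ler_pXn2r (n := 2)) ?nnegrE ?mulr_ge0 ?sqrtr_ge0 // exprMn !norm2_sqr.
apply: (@le_trans _ _ ((\prod_(j in B) norm2 (col j A)) ^+ 2)); last first.
  rewrite ler_pXn2r ?nnegrE //; first exact: DeltaA_ge.
  by apply: prodr_ge0 => j _; exact: sqrtr_ge0.
rewrite prod_norm2_sqr.
(* A vector orthogonal to the columns in [B] is orthogonal to all tight columns, which they span,
   and to column [k]; the vertex condition makes it zero. *)
have orth d : (forall j, j \in B -> ip (col j A) d = 0) -> d = 0.
  move=> dB; apply: tight; last exact: dB.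
  move=> j /eqP jT; have [|c sc ->] := spB j; first by rewrite inE.
  rewrite (mulmx_supported A sc) ip_suml big1 // => i iB'.
  by rewrite ipZl dB // mulr0.
set C := cols A B; set G := C^T *m C.
have colC i : col i C = col (enum_val i) A by apply/colP => l; rewrite !mxE.
have Gd i : G i i = ip (col (enum_val i) A) (col (enum_val i) A) by rewrite entry_ip_col colC.
have pG : sym_posdef G by apply: gram_posdef; apply/indepP.
have dG : 1 <= \det G.
  have GE : G = int_mx R ((colsub (fun i : 'I_#|B| => enum_val i) A0)^T *m colsub (fun i : 'I_#|B| => enum_val i) A0).
    rewrite /int_mx map_mxM -map_trmx /G /C /cols.
    by congr (_^T *m _); apply/matrixP => i j; rewrite !mxE.
  by rewrite GE; apply: det_int_ge1; rewrite -GE.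
have uG : G \in unitmx by rewrite unitmxE unitfE gt_eqF // (lt_le_trans ltr01).
set H := invmx G; have GH : G *m H = 1%:M by rewrite mulmxV.
set kp := enum_rank_in kB k.
have kpE : enum_val kp = k by rewrite enum_rankK_in.
have Cy : C^T *m y = delta_mx kp ord0.
  apply/colP => i; rewrite -ip_col colC !mxE andbT.
  have [->|ik] := eqVneq i kp; first by rewrite kpE.
  have := subsetP sB _ (enum_valP i); rewrite !inE -[X in _ == X]kpE (inj_eq enum_val_inj).
  by rewrite (negPf ik) /= => /eqP.
(* Both sides have the same products with the columns in [B]. As [C^T y] is a unit vector, [|y|^2]
   becomes a diagonal entry of [H]. *)
have yE : y = C *m (H *m (C^T *m y)).
  apply/eqP; rewrite -subr_eq0; apply/eqP; apply: orth => j jB.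
  have -> : col j A = col (enum_rank_in jB j) C by rewrite colC enum_rankK_in.
  by rewrite ip_col mulmxBr !mulmxA -/G GH mul1mx subrr mxE.
have -> : ip y y = H kp kp.
  rewrite {1}yE ip_mull Cy -colE ip_delta mxE.
  by [].
have -> : ip (col k A) (col k A) = G kp kp by rewrite Gd kpE.
apply: le_trans (inv_diag_le kp pG dG GH) _.
rewrite (big_enum_val (fun j => ip (col j A) (col j A))) le_eqVlt; apply/orP; left; apply/eqP.
by apply: eq_bigr => i _; rewrite Gd.
Qed.

Lemma int_col_ge1 j : col j A != 0 -> 1 <= ip (col j A) (col j A).
Proof.
move=> j0.
have E : ip (col j A) (col j A) = (\sum_i A0 i j ^+ 2)%:~R.
  by rewrite ipE rmorph_sum /=; apply: eq_bigr => i _; rewrite !mxE rmorphXn /= expr2.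
by move: j0; rewrite -ip_gt0 E ltr0z ler1z.
Qed.

Lemma width k y0 : (0 < m)%N -> 1 <= DeltaA A ->
  is_solution A y0 -> 0 < ip (col k A) y0 ->
  exists y, [/\ is_solution A y, ip y y <= 1 &
    thetaA A * norm2 (col k A) <= ip (col k A) y].
Proof.
move=> m0 D1 /is_solutionP sol k1.
have [|||y [soly yk tight]] := @vertex_solution _ _ A k ((ip (col k A) y0)^-1 *: y0).
- exact: rkA.
- by apply/is_solutionP => j; rewrite ipZr mulr_ge0 // invr_ge0 ltW.
- by rewrite ipZr mulVf // gt_eqF.
have le := vertex_norm yk tight.
have y0' : y != 0 by apply: contra_eq_neq yk => ->; rewrite ip0r eq_sym oner_neq0.
have ny : 0 < norm2 y by rewrite norm2E sqrtr_gt0 ip_gt0.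
exists ((norm2 y)^-1 *: y); split.
- by move/is_solutionP: soly => soly; apply/is_solutionP => j; rewrite ipZr mulr_ge0 // invr_ge0 ltW.
- by rewrite ipZr ipZl mulrA -expr2 exprVn norm2_sqr mulVf // ip_eq0.
rewrite ipZr yk mulr1 -[_^-1]mul1r ler_pdivlMr // /thetaA -mulrA [norm2 _ * _]mulrC.
have Dpos : 0 < DeltaA A by exact: lt_le_trans ltr01 D1.
rewrite ler_pdivrMl ?mulr_gt0 ?exprn_gt0 ?ltr0n // mulr1.
(* The vertex gives the factor [1 / Delta]; [theta] is no larger, as [m] and [Delta] are at least
   1. *)
apply: le_trans le _; rewrite expr2 [_ ^+ 2 in leRHS]expr2.
have m1 : 1 <= m%:R :> R by rewrite ler1n.
have : 1 <= m%:R * m%:R :> R by nra.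
nra.
Qed.

End Width.

(** * Bounds in terms of the encoding length *)

Section EncodingLength.
Variable R : realType.

Lemma sum_le_prod I (s : seq I) (x : I -> R) : (forall i, 0 <= x i) ->
  1 + \sum_(i <- s) x i <= \prod_(i <- s) (1 + x i).
Proof.
move=> x0; elim: s => [|i s IH]; first by rewrite !big_nil addr0.
rewrite !big_cons; have xi := x0 i.
have s0 : 0 <= \sum_(j <- s) x j by apply: sumr_ge0.
nra.
Qed.

Lemma bits_ge (z : int) : 1 + (z%:~R : R) ^+ 2 <= (4 ^ bits z)%:R.
Proof.
have h := @up_logP 2 `|z|%N.+1 isT.
have -> : (z%:~R : R) ^+ 2 = `|z|%N%:R ^+ 2 by rewrite natr_absz intr_norm real_normK // num_real.
rewrite -natrX -(natrD _ 1) ler_nat /bits.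
have -> : (4 ^ (up_log 2 `|z|.+1).+1 = 4 * (2 ^ up_log 2 `|z|.+1) ^ 2)%N.
  by rewrite expnS; congr (_ * _)%N; rewrite -[4%N]/(2 ^ 2)%N -!expnM mulnC.
nia.
Qed.

Variables (m n : nat) (A0 : 'M[int]_(m, n)).
Let A := int_mx R A0.

(** A squared column norm is at most the product of the factors [1 + a_ij^2], each at most 4 to the
    number of bits of the entry; columns outside [B] only contribute factors of at least 1. *)
Lemma DeltaA_bits : DeltaA A <= (2 ^ encoding_length A0)%:R.
Proof.
apply: DeltaA_le => // B _.
rewrite -(ler_pXn2r (n := 2)) ?nnegrE //; last by apply: prodr_ge0 => j _; exact: sqrtr_ge0.
rewrite prod_norm2_sqr -natrX -expnM mulnC expnM /encoding_length exchange_big expn_sum natr_prod.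
have le1 j : (0 < (2 ^ 2) ^ (\sum_i bits (A0 i j)))%N by rewrite !expn_gt0.
rewrite [leRHS](bigID (mem B)) /=; apply: (@le_trans _ _ (\prod_(j in B) ((2 ^ 2) ^ (\sum_i bits (A0 i j)))%:R)).
  apply: ler_prod => j _; rewrite ip_ge0 /= expn_sum natr_prod ipE.
  apply: le_trans (_ : \prod_i (1 + (A i j) ^+ 2) <= _).
    apply: le_trans (sum_le_prod _ _) => [|i]; last exact: sqr_ge0.
    by rewrite ler_wpDl //; apply: ler_sum => i _; rewrite !mxE expr2.
  apply: ler_prod => i _; rewrite addr_ge0 ?sqr_ge0 //= mxE; exact: bits_ge.
apply: ler_peMr; first by apply: prodr_ge0.
rewrite -natr_prod (ler_nat _ 1); apply: prodn_gt0 => j; exact: le1.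
Qed.

Lemma encoding_length_ge : (m * n <= encoding_length A0)%N.
Proof.
rewrite /encoding_length -{1}[m]card_ord -sum1_card big_distrl /=; apply: leq_sum => i _.
rewrite mul1n -{1}[n]card_ord -sum1_card; exact: leq_sum.
Qed.

End EncodingLength.

(** * The von Neumann algorithm *)

Section VonNeumann.
Variable R : realType.
Local Notation cst := (@real_cst R).

Definition convex_comb r n (A : 'M[R]_(r, n)) (T : {set 'I_n}) (Q : 'M[R]_r)
    (x : 'cV[R]_n) (y : 'cV[R]_r) : Prop :=
  [/\ forall i, 0 <= x i ord0, forall i, i \notin T -> x i ord0 = 0,
      \sum_(i in T) x i ord0 = 1
    & y = \sum_(i in T) (x i ord0 / normQ Q (col i A)) *: col i A].

Definition solver_post r n (A : 'M[R]_(r, n)) (T : {set 'I_n}) (Q : 'M[R]_r) (eps : R)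
    (xy : 'cV[R]_n * 'cV[R]_r) : Prop :=
  convex_comb A T Q xy.1 xy.2 /\
  ((forall i, i \in T -> 0 < (A^T *m Q *m xy.2) i ord0) \/ normQ Q xy.2 <= eps).

Lemma normQE p (Q : 'M[R]_p) v : normQ Q v = Num.sqrt (ip v (Q *m v)).
Proof. by rewrite /normQ /ip mulmxA. Qed.

Lemma normQ_sqr p (Q : 'M[R]_p) v : sym_posdef Q -> normQ Q v ^+ 2 = ip v (Q *m v).
Proof. by move=> pQ; rewrite normQE sqr_sqrtr //; case: (posdef_psd pQ). Qed.

Lemma normQ_gt0 p (Q : 'M[R]_p) v : sym_posdef Q -> v != 0 -> 0 < normQ Q v.
Proof. by move=> pQ v0; rewrite normQE sqrtr_gt0; apply: posdef_gt0. Qed.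

(* [s] is the squared norm of the [i]-th iterate and [z] its product with the selected unit vector: the squared norm of the [i]-th iterate is at most 1 / (i + 1). *)
Lemma perceptron_step (s z : R) (i : nat) : 0 <= s -> z <= 0 -> s * i.+1%:R <= 1 ->
  let l := (s - z) / (s - z - z + 1) in
  [/\ 0 < s - z - z + 1, 0 <= l, 0 <= 1 - l &
   ((1 - l) ^+ 2 * s + 2 * (1 - l) * l * z + l ^+ 2) * i.+2%:R <= 1].
Proof.
move=> s0 z0 si l.
set D := s - z - z + 1.
have D0 : 0 < D by rewrite /D; nra.
have l0 : 0 <= l by apply: divr_ge0; rewrite /D; nra.
have l'E : 1 - l = (1 - z) / D by rewrite /l -/D /D; field; rewrite gt_eqF.
have l'0 : 0 <= 1 - l by rewrite l'E; apply: divr_ge0; nra.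
split=> //.
have -> : (1 - l) ^+ 2 * s + 2 * (1 - l) * l * z + l ^+ 2 = (s - z ^+ 2) / D.
  by rewrite /l -/D /D; field; rewrite gt_eqF.
rewrite mulrAC ler_pdivrMr // mul1r.
have s1 : 0 < s + 1 by nra.
rewrite -(ler_pM2r s1).
(* So the new squared norm is at most [s / (s + 1)]: its reciprocal grows by at least 1. *)
have e1 : (s - z ^+ 2) * (s + 1) <= s * D by rewrite /D; nra.
have e2 : s * i.+2%:R <= s + 1 by rewrite -natr1 mulrDr mulr1 addrC lerD2l.
rewrite mulrAC; apply: (@le_trans _ _ (s * D * i.+2%:R)).
  by rewrite ler_wpM2r.
by rewrite mulrAC mulrC ler_wpM2l // ltW.
Qed.

(** All matrix products precede the loop; updating [z] from the Gram matrix keeps an iteration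
    linear in [n + r]. *)
Lemma spec_vonNeumann r n (A : 'M[R]_(r, n)) (T : {set 'I_n}) (Q : 'M[R]_r) (eps : R) (N : nat) :
  T != finset.set0 -> (forall i, i \in T -> col i A != 0) -> sym_posdef Q -> 0 < eps ->
  1 <= N%:R * eps ^+ 2 ->
  spec (2 * r * (r * n) + 2 * r * (n * n) + 2 * n + r + N.+1 * (18 * n + 3 * r))
    (vonNeumann cst r n A T Q eps) (solver_post A T Q eps).
Proof.
move=> Tn0 A0 pQ eps0 Neps t; rewrite /vonNeumann.
have [QT _] := pQ.
have sT : (size (enum T) <= n)%N by rewrite -cardE -[X in (_ <= X)%N]card_ord max_card.
case eT : {1}(enum T) => [|k0 s0].
  by case/set0Pn: Tn0 => i; rewrite -mem_enum eT.
have k0T : k0 \in T by rewrite -mem_enum eT mem_head.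
have n0 : (0 < n)%N by case: (n) k0 {eT k0T} => [[]|].
clear s0 eT.
apply: (wp_bind_spec (spec_mulM _ _)) => _ t1 -> le1.
apply: (wp_bind_spec (spec_mulM _ _)) => _ t2 -> le2.
set G := A^T *m (Q *m A).
have colQA j : col j (Q *m A) = Q *m col j A by rewrite !colE mulmxA.
have GE i j : G i j = ip (col i A) (Q *m col j A) by rewrite entry_ip_col colQA.
pose nu i := normQ Q (col i A).
have nuG i : Num.sqrt (G i i) = nu i by rewrite GE -normQE.
have nu0 i : i \in T -> 0 < nu i by move=> /A0; exact: normQ_gt0.
have nu2 i : nu i ^+ 2 = G i i by rewrite /nu normQ_sqr // GE.
apply: (wp_bind_spec (spec_tabulate_fun (F := nu) (c := 1) _ _)) => [i|nrm t3 Hnrm le3].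
  rewrite mem_enum => iT; rewrite -nuG; apply: spec_sqrt.
  by rewrite -nu2 sqr_ge0.
have {}le3 : (t3 <= t2 + n)%N by apply: leq_trans le3 _; rewrite mul1n leq_add2l; exact: sT.
have {}Hnrm i : i \in T -> nrm i = nu i by move=> iT; rewrite Hnrm ?mem_enum.
pose y0 := (nu k0)^-1 *: col k0 A.
apply: (wp_bind_spec (c := 1 * (r * 1)) (P := eq^~ y0)) => [|_ t4 -> le4].
  apply: spec_weaken (spec_build_mx (c := 1) (F := fun i _ => A i k0 / nu k0) _) _ _ => // [i j|_ ->].
    by rewrite Hnrm //; apply: spec_div; rewrite gt_eqF ?nu0.
  by apply/matrixP => i j; rewrite !mxE mulrC.
apply: (wp_bind_spec (c := 1 * (n * 1)) (P := eq^~ (A^T *m Q *m y0))) => [|_ t5 -> le5].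
  apply: spec_weaken (spec_build_mx (c := 1) (F := fun i _ => G i k0 / nu k0) _) _ _ => // [i j|_ ->].
    by rewrite Hnrm //; apply: spec_div; rewrite gt_eqF ?nu0.
  rewrite /y0 -scalemxAr -mulmxA; apply/matrixP => i j; rewrite ord1.
  by rewrite [LHS]mxE [RHS]mxE -ip_col -GE mulrC.
pose c_it := (18 * n + 3 * r)%N.
pose Inv k (xyz : 'cV[R]_n * 'cV[R]_r * 'cV[R]_n) t' :=
  exists i, [/\ (k + i = N)%N, (t' <= t5 + i * c_it)%N, convex_comb A T Q xyz.1.1 xyz.1.2,
    xyz.2 = A^T *m Q *m xyz.1.2 & ip xyz.1.2 (Q *m xyz.1.2) * i.+1%:R <= 1].
(* While the norm exceeds [eps], [(i + 1) * eps^2 < 1 <= N * eps^2]; this keeps the variant [N - i]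
   positive. *)
have small_end (s : R) i : s * i.+1%:R <= 1 -> eps < Num.sqrt s -> (i.+1 < N)%N.
  move=> si es; rewrite -(ltr_nat R) ltNge; apply/negP => Ni.
  have e2 : eps ^+ 2 < s.
    have s0 : 0 < s by rewrite -sqrtr_gt0 (lt_trans eps0).
    by rewrite -[s]sqr_sqrtr ?ltW // ltr_pXn2r ?nnegrE // ltW // (lt_trans eps0).
  have i0 : 0 < i.+1%:R :> R by rewrite ltr0n.
  have := e2; rewrite -(ltr_pM2r i0) => lt.
  have : N%:R * eps ^+ 2 <= i.+1%:R * eps ^+ 2 by rewrite ler_wpM2r // sqr_ge0.
  rewrite [i.+1%:R * _]mulrC => le; have := le_lt_trans le (lt_le_trans lt si).
  by rewrite ltNge Neps.
apply: (wp_iter (Inv := Inv) (k := N)); last first.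
  exists 0%N; rewrite addn0 mul0n addn0; split=> //=.
    split=> [i|i iT||].
    - by rewrite mxE; case: ifP => _; rewrite ?ler01.
    - by rewrite mxE; case: eqP iT => // ->; rewrite k0T.
    - rewrite (bigD1 k0) //= mxE eqxx big1 ?addr0 // => i /andP [_ ik].
      by rewrite mxE (negPf ik).
    rewrite (bigD1 k0) //= mxE eqxx big1 ?addr0 => [|i /andP [_ ik]].
      by rewrite /y0 /real_cst div1r.
    by rewrite mxE (negPf ik) /real_cst mul0r scale0r.
  rewrite /y0 -scalemxAr ipZr ipZl mulr1 -GE mulrA -expr2 exprVn -nu2.
  by rewrite mulVf // expf_neq0 // gt_eqF // nu0.
clear -sT n0 GE nuG nu0 nu2 Hnrm small_end QT pQ le1 le2 le3 le4 le5.
move=> k [[x y] z] t' [i [ki le' cc zE sm]]; rewrite /= in cc zE sm.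
have [x0 xT x1 yE] := cc.
set s := ip y (Q *m y) in sm.
have zip j : z j ord0 = ip (col j A) (Q *m y) by rewrite zE -mulmxA -ip_col.
have s0 : 0 <= s by have [_ h] := posdef_psd pQ; exact: h.
apply: (wp_bind_spec (c := 3 * size (enum T)) (P := eq^~ s)) => [|_ t6 -> le6].
  apply: spec_weaken (spec_sumM (c := 2) (F := fun i => x i ord0 / nu i * z i ord0) _) _ _ => // [j|_ ->].
    rewrite mem_enum => jT; rewrite Hnrm //.
    apply: (@spec_bind _ 1 1 _ _ _ _ _ _ (spec_div _ _)) => [|_ ->]; last exact: spec_mul.
    by rewrite gt_eqF ?nu0.
  rewrite big_enum /s {1}yE ip_suml; apply: eq_bigr => j jT.
  by rewrite ipZl zip.
have {}le6 : (t6 <= t' + 3 * n)%N by apply: leq_trans le6 _; rewrite leq_add2l leq_mul2l; exact: sT.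
apply: (wp_bind_spec (spec_sqrt s0)) => _ t7 -> le7.
apply: (wp_bind_spec (spec_less _ _)) => _ t8 -> le8.
have fin t9 : (t9 <= t8 + n -> t9 <= t + (2 * r * (r * n) + 2 * r * (n * n) + 2 * n + r + N.+1 * (18 * n + 3 * r)))%N.
  have ci : (3 * n + 2 + n <= c_it)%N by rewrite /c_it; lia.
  have le : (i * c_it <= N * c_it)%N by rewrite leq_mul2r -ki leq_addl orbT.
  rewrite [(N.+1 * _)%N]mulSn -/c_it; move: le ci le' sT le1 le2 le3 le4 le5 le6 le7 le8.
  clearbody c_it.
  move: (2 * r * (r * n))%N (2 * r * (n * n))%N (i * c_it)%N (N * c_it)%N => *; lia.
case: ltP => [es|es] /=; last first.
  split; last by apply: fin; lia.
  by split=> //; right; rewrite normQE.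
apply: (wp_bind_spec (spec_tabulate_fun (F := fun i => 0 < z i ord0) (c := 1) _ _)) => [j _|pos t9 Hpos le9].
  exact: spec_less.
have {}le9 : (t9 <= t8 + n)%N by apply: leq_trans le9 _; rewrite mul1n leq_add2l; exact: sT.
have {}Hpos j : j \in T -> pos j = (0 < z j ord0) by move=> jT; rewrite Hpos ?mem_enum.
case: ifP => [/forallP allp|/negbT nallp].
  split; last exact: fin.
  split=> //; left => j jT; rewrite -zE -Hpos //.
  by have := allp j; rewrite jT.
have iN := small_end _ _ sm es.
have exk : exists j, (j \in T) && ~~ pos j.
  move: nallp; rewrite negb_forall => /existsP [j]; rewrite negb_imply => H; by exists j.
apply: (wp_choose exk) => j /andP [jT]; rewrite Hpos // -leNgt => zj.
have nuj := nu0 _ jT.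
apply: (wp_bind_spec (spec_div _ _)) => [|_ t11 -> le11]; first by rewrite Hnrm // gt_eqF.
rewrite Hnrm //; set zk := z j ord0 / nu j.
have zk0 : zk <= 0 by rewrite /zk mulr_le0_ge0 // invr_ge0 ltW.
have [D0 l0 l'0 step] := perceptron_step s0 zk0 sm.
apply: (wp_bind_spec (spec_sub _ _)) => _ t12 -> le12.
apply: (wp_bind_spec (spec_sub _ _)) => _ t13 -> le13.
apply: (wp_bind_spec (spec_add _ _)) => _ t14 -> le14.
apply: (wp_bind_spec (spec_div _ _)) => [|_ t15 -> le15]; first by rewrite gt_eqF.
set l := _ / _ in l0 l'0 step *.
apply: (wp_bind_spec (spec_sub _ _)) => _ t16 -> le16.
pose x' := (1 - l) *: x + l *: delta_mx j ord0.
pose y' := (1 - l) *: y + (l / nu j) *: col j A.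
apply: (wp_bind_spec (c := 2 * (n * 1)) (P := eq^~ x')) => [|_ t17 -> le17].
  apply: spec_weaken (spec_build_mx (c := 2) (F := fun i _ => (1 - l) * x i ord0 + (if i == j then l else 0)) _) _ _ => // [i1 j1|_ ->].
    apply: (@spec_bind _ 1 1 _ _ _ _ _ _ (spec_mul _ _)) => _ ->.
    case: (i1 == j); first exact: spec_add.
    by apply: spec_weaken (spec_ret _ _) _ _ => // _ ->; rewrite addr0.
  apply/matrixP => i1 j1; rewrite (ord1 j1) !mxE ?eqxx ?andbT; congr (_ + _).
  by case: (i1 == j); rewrite ?mulr1 ?mulr0.
apply: (wp_bind_spec (spec_div _ _)) => [|_ t18 -> le18]; first by rewrite gt_eqF.
apply: (wp_bind_spec (c := 3 * (r * 1)) (P := eq^~ y')) => [|_ t19 -> le19].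
  apply: spec_weaken (spec_build_mx (c := 3) (F := fun i _ => (1 - l) * y i ord0 + l / nu j * A i j) _) _ _ => // [i1 j1|_ ->].
    apply: (@spec_bind _ 1 2 _ _ _ _ _ _ (spec_mul _ _)) => _ ->.
    apply: (@spec_bind _ 1 1 _ _ _ _ _ _ (spec_mul _ _)) => _ ->.
    exact: spec_add.
  by apply/matrixP => i1 j1; rewrite (ord1 j1) !mxE.
apply: (wp_bind_spec (c := 3 * (n * 1)) (P := eq^~ (A^T *m Q *m y'))) => [|_ t20 -> le20].
  apply: spec_weaken (spec_build_mx (c := 3) (F := fun i _ => (1 - l) * z i ord0 + l / nu j * G i j) _) _ _ => // [i1 j1|_ ->].
    apply: (@spec_bind _ 1 2 _ _ _ _ _ _ (spec_mul _ _)) => _ ->.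
    apply: (@spec_bind _ 1 1 _ _ _ _ _ _ (spec_mul _ _)) => _ ->.
    exact: spec_add.
  rewrite /y' mulmxDr -!scalemxAr -zE; apply/matrixP => i1 j1.
  by rewrite (ord1 j1) [LHS]mxE [RHS]mxE [in RHS]mxE [X in _ = _ + X]mxE -(mulmxA A^T) -ip_col -GE.
clearbody l.
exists (k.-1); first by clear -ki iN; lia.
exists i.+1; split=> /=.
- by clear -ki iN; lia.
(* An iteration makes 9 operations outside the loops over rows and columns; they are absorbed
   because [n] is positive. *)
- have ci : (9 * n + 3 * r + 9 <= c_it)%N by rewrite /c_it; clear -n0; lia.
  rewrite mulSn; clearbody c_it; move: (i * c_it)%N le' => p le'.
  by clear -n0 ci le' le6 le7 le8 le9 le11 le12 le13 le14 le15 le16 le17 le18 le19 le20; lia.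
- split=> [i1|i1 i1T||].
  + by rewrite !mxE; apply: addr_ge0; apply: mulr_ge0 => //; rewrite ler0n.
  + rewrite !mxE xT // mulr0 add0r andbT; case: eqP i1T => [->|]; first by rewrite jT.
    by rewrite mulr0.
  + have -> : \sum_(i1 in T) x' i1 ord0 = (1 - l) * \sum_(i1 in T) x i1 ord0 + l * \sum_(i1 in T) (delta_mx j ord0 : 'cV[R]_n) i1 ord0.
      by rewrite !mulr_sumr -big_split; apply: eq_bigr => i1 _; rewrite !mxE.
    rewrite x1 (bigD1 j) //= mxE !eqxx big1 => [|i1 /andP [_ ij]].
      by rewrite addr0 !mulr1 subrK.
    by rewrite mxE (negPf ij).
  + have -> : \sum_(i1 in T) (x' i1 ord0 / nu i1) *: col i1 A =
       (1 - l) *: (\sum_(i1 in T) (x i1 ord0 / nu i1) *: col i1 A) +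
       \sum_(i1 in T) (l * (delta_mx j ord0 : 'cV[R]_n) i1 ord0 / nu i1) *: col i1 A.
      rewrite scaler_sumr -big_split; apply: eq_bigr => i1 _ /=.
      by rewrite !mxE scalerA -scalerDl; congr (_ *: _); ring.
    rewrite -yE (bigD1 j) //= mxE !eqxx mulr1 big1 ?addr0 // => i1 /andP [_ ij].
    by rewrite mxE (negPf ij) mulr0 mul0r scale0r.
- by [].
have -> : ip y' (Q *m y') = (1 - l) ^+ 2 * s + 2 * (1 - l) * l * zk + l ^+ 2; last exact: step.
have yQa : ip y (Q *m col j A) = z j ord0 by rewrite zip [RHS]ipC ip_mull QT.
rewrite /y' mulmxDr -!scalemxAr !ipDr !ipDl !ipZr !ipZl -zip yQa -GE -nu2 -/s /zk.
by field; rewrite gt_eqF.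
Qed.

End VonNeumann.

(** * The rescaling loop *)

Section Invariant.
Variable R : realType.
Local Notation cst := (@real_cst R).
Variables (m n : nat) (A0 : 'M[R]_(m, n)) (theta eps M : R).
Hypothesis m_gt0 : (0 < m)%N.
Hypotheses (theta_gt0 : 0 < theta) (theta_le1 : theta <= 1).
Hypothesis eps_def : eps = (11 * m)%:R^-1.
Hypothesis M_def : eps * M = theta ^- 2.
Hypothesis width : forall k y0, is_solution A0 y0 -> 0 < ip (col k A0) y0 ->
  exists y, [/\ is_solution A0 y, ip y y <= 1 & theta * norm2 (col k A0) <= ip (col k A0) y].

(* [N] counts the rescalings; the last condition bounds it, since a rescaling multiplies [\det st_R] by at least 3/2 and a removal divides it by at most [M]. *)
Definition inv (N : nat) (st : state R m n) : Prop :=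
  [/\ [/\ st_A st = (st_U st)^T *m A0, (st_U st)^T *m st_U st = 1%:M,
          forall j, (j \in st_T st) = (col j (st_A st) != 0)
        & forall y, is_solution A0 y -> y = st_U st *m ((st_U st)^T *m y)],
      sym_posdef (st_R st) /\ st_R st *m st_Q st = 1%:M,
      forall y, is_solution A0 y -> ip y y <= 1 ->
        ip ((st_U st)^T *m y) (st_R st *m ((st_U st)^T *m y)) <= 1,
      \tr (st_R st) <= M
    & (st_r st <= m)%N /\ (3 / 2) ^+ N <= \det (st_R st) * M ^+ (m - st_r st)].

(** The exit condition of the removal loop; the trace bound for the next rescaling depends on it. *)
Definition purged (st : state R m n) : Prop := forall j, j \in st_T st ->
  theta * norm2 (col j (st_A st)) <= normQ (st_Q st) (col j (st_A st)).

Lemma eps_gt0 : 0 < eps.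
Proof. by rewrite eps_def invr_gt0 ltr0n muln_gt0. Qed.

(** Gives the trace bound for the initial identity matrix: [eps * m = 1 / 11 <= 1 <= theta^-2]. *)
Lemma M_ge : m%:R <= M.
Proof.
have e0 := eps_gt0; rewrite -(ler_pM2l e0) M_def eps_def.
have -> : (11 * m)%:R^-1 * m%:R = 11^-1 :> R.
  by rewrite natrM; field; rewrite !pnatr_eq0 -lt0n m_gt0.
apply: (@le_trans _ _ 1); first by rewrite invf_le1 // (ler_nat _ 1).
by rewrite invf_ge1 ?exprn_gt0 // exprn_ile1 // ltW.
Qed.

Lemma M_gt0 : 0 < M.
Proof. by apply: lt_le_trans M_ge; rewrite ltr0n. Qed.

Lemma inv_dims N st : inv N st -> (st_r st <= m)%N.
Proof. by case=> _ _ _ _ []. Qed.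

Lemma mxtrace_posdef_ge0 p (S : 'M[R]_p) : sym_posdef S -> 0 <= \tr S.
Proof. by move=> pS; apply: sumr_ge0 => i _; rewrite ltW // posdef_diag. Qed.

(** Each diagonal entry is at most the trace, so Hadamard's inequality gives [\det R <= M^r]; the
    factor [M^(m - r)] of the invariant completes the exponent. *)
Lemma inv_count N st : inv N st -> (3 / 2) ^+ N <= M ^+ m.
Proof.
case=> _ [pS _] _ trM [rm le]; apply: le_trans le _.
have M0 := ltW M_gt0.
rewrite -[X in _ <= _ ^+ X](subnKC rm) exprD ler_wpM2r ?exprn_ge0 //.
apply: le_trans (hadamard pS) _.
rewrite -[X in _ ^+ X]card_ord -prodr_const; apply: ler_prod => i _.
rewrite ltW ?posdef_diag //=; apply: le_trans trM; rewrite /mxtrace (bigD1 i) //= lerDl.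
by apply: sumr_ge0 => j _; rewrite ltW // posdef_diag.
Qed.

Lemma id_mxE p : id_mx cst p = 1%:M.
Proof. by apply/matrixP => i j; rewrite !mxE /real_cst; case: eqP. Qed.

(** The [Q]-norm is the support function of the ellipsoid of [S]. *)
Lemma ip_le_normQ p (S Q : 'M[R]_p) a w : sym_posdef S -> S *m Q = 1%:M ->
  ip w (S *m w) <= 1 -> 0 <= ip a w -> ip a w <= normQ Q a.
Proof.
move=> pS SQ w1 aw; have pQ := posdef_inv pS SQ.
rewrite -(ler_pXn2r (n := 2)) ?nnegrE ?sqrtr_ge0 // normQ_sqr //.
apply: le_trans (ip_CS _ _ pS SQ) _; apply: ler_piMr => //.
by have [_ h] := posdef_psd pQ; exact: h.
Qed.

Lemma inv_init : inv 0 (State A0 [set j | col j A0 != 0] 1%:M 1%:M 1%:M).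
Proof.
split=> /=.
- split=> [||j|y _]; rewrite ?inE ?trmx1 ?mul1mx //.
- by split; [exact: posdef1 | rewrite mul1mx].
- by move=> y _; rewrite trmx1 !mul1mx.
- by rewrite mxtrace1 M_ge.
- by rewrite det1 subnn expr0 mulr1.
Qed.

Lemma purged_init : purged (State A0 [set j | col j A0 != 0] 1%:M 1%:M 1%:M).
Proof.
by move=> j _ /=; rewrite normQE mul1mx -norm2E ler_piMl // sqrtr_ge0.
Qed.

Lemma orth_complementP p (a : 'cV[R]_p) (W : 'M[R]_(p, p.-1)) (S Q : 'M[R]_p) :
  a != 0 -> W^T *m W = 1%:M -> a^T *m W = 0 -> S *m Q = 1%:M ->
  [/\ forall v, ip a v = 0 -> v = W *m (W^T *m v),
      \det (W^T *m (S *m W)) * ip a a = \det S * ip a (Q *m a)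
    & \tr (W^T *m (S *m W)) * ip a a + ip a (S *m a) = \tr S * ip a a].
Proof.
case: p a W S Q => [|p] a W S Q a0 WW aW SQ.
  by case/eqP: a0; apply/colP => -[].
split; first by move=> v; exact: orth_complement_proj.
  exact: det_orth_complement.
exact: trace_orth_complement.
Qed.

(** * Rescaling and removal preserve the invariant *)

Section State.
Variables (r : nat) (A : 'M[R]_(r, n)) (T : {set 'I_n}) (S Q : 'M[R]_r) (U : 'M[R]_(m, r)).
Variable N : nat.
Hypothesis invS : inv N (State A T S Q U).

Let AE : A = U^T *m A0. Proof. by case: invS => -[]. Qed.
Let UU : U^T *m U = 1%:M. Proof. by case: invS => -[]. Qed.
Let TE j : (j \in T) = (col j A != 0). Proof. by case: invS => -[_ _ h _] _ _ _ _; exact: h. Qed.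
Let imU y : is_solution A0 y -> y = U *m (U^T *m y).
Proof. by case: invS => -[_ _ _ h] _ _ _ _; exact: h. Qed.
Let pS : sym_posdef S. Proof. by case: invS => _ []. Qed.
Let SQ : S *m Q = 1%:M. Proof. by case: invS => _ []. Qed.
Let ell y : is_solution A0 y -> ip y y <= 1 -> ip (U^T *m y) (S *m (U^T *m y)) <= 1.
Proof. by case: invS => _ _ h _ _; exact: h. Qed.
Let trM : \tr S <= M. Proof. by case: invS. Qed.
Let pQ : sym_posdef Q. Proof. exact: posdef_inv SQ. Qed.

Let colAE j : col j A = U^T *m col j A0. Proof. by rewrite AE !colE mulmxA. Qed.

(** Solutions lie in the image of [U], so projecting a column does not change its products with
    them. Hence no solution is strict on a deleted column. *)
Lemma inv_colE j y : is_solution A0 y -> ip (col j A) (U^T *m y) = ip (col j A0) y.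
Proof.
by move=> sol; rewrite colAE {2}(imU sol) ip_mull trmxK.
Qed.

Lemma inv_max_support0 : T = finset.set0 -> max_support_solution A0 0.
Proof.
move=> T0; split=> [j|y' sol]; first by rewrite mulmx0 mxE.
apply/subsetP => j; rewrite !inE -ip_col -(inv_colE _ sol).
have := TE j; rewrite T0 inE => /esym/negbT; rewrite negbK => /eqP ->.
by rewrite ip0l ltxx.
Qed.

Lemma inv_max_support y : (forall j, j \in T -> 0 < ip (col j A) (Q *m y)) ->
  max_support_solution A0 (U *m (Q *m y)).
Proof.
move=> pos.
have E j : ip (col j A0) (U *m (Q *m y)) = ip (col j A) (Q *m y).
  by rewrite colAE ip_mulr.
split.
  apply/is_solutionP => j; rewrite E; have [/pos/ltW //|] := boolP (j \in T).
  by rewrite TE negbK => /eqP ->; rewrite ip0l.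
move=> y' sol; apply/subsetP => j; rewrite !inE -!ip_col -(inv_colE _ sol) E => h.
apply: pos; rewrite TE; apply: contraTneq h => ->.
by rewrite ip0l ltxx.
Qed.

Section Rescale.
Hypothesis pg : purged (State A T S Q U).
Variables (x : 'cV[R]_n) (y : 'cV[R]_r).
Hypothesis cc : convex_comb A T Q x y.
Hypothesis ysmall : normQ Q y <= eps.

Let c k := x k ord0 / ip (col k A) (Q *m col k A).
Definition rescaled : 'M[R]_r :=
  (1 + eps)^-1 *: (S + \matrix_(i, j) \sum_k c k * A i k * A j k).
(** Splitting each weight into two square roots turns the update into [B B^T], the form required by
    [det_posdefD]. *)
Let B : 'M[R]_(r, n) := \matrix_(i, k) (Num.sqrt (c k) * A i k).

Let x0 k : 0 <= x k ord0. Proof. by case: cc. Qed.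
Let xT k : k \notin T -> x k ord0 = 0. Proof. by case: cc => _ h _ _; exact: h. Qed.
Let x1 : \sum_(k in T) x k ord0 = 1. Proof. by case: cc. Qed.
Let yE : y = \sum_(k in T) (x k ord0 / normQ Q (col k A)) *: col k A. Proof. by case: cc. Qed.
Let e0 := eps_gt0.
Let e1 : 0 < 1 + eps. Proof. by rewrite addr_gt0. Qed.

Let c0 k : 0 <= c k.
Proof. by rewrite divr_ge0 //; have [_ h] := posdef_psd pQ; exact: h. Qed.

Let colB k : col k B = Num.sqrt (c k) *: col k A.
Proof. by apply/colP => i; rewrite !mxE. Qed.

Let BB : \matrix_(i, j) \sum_k c k * A i k * A j k = B *m B^T.
Proof.
apply/matrixP => i j; rewrite !mxE; apply: eq_bigr => k _; rewrite !mxE.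
by rewrite -[c k in LHS]sqr_sqrtr //; ring.
Qed.

Let SE : rescaled = (1 + eps)^-1 *: (S + B *m B^T). Proof. by rewrite /rescaled BB. Qed.

Let trB (X : 'M[R]_r) : \tr (B^T *m (X *m B)) = \sum_k c k * ip (col k A) (X *m col k A).
Proof.
apply: eq_bigr => k _; rewrite entry_ip_col.
have -> : col k (X *m B) = Num.sqrt (c k) *: (X *m col k A).
  by rewrite colE -mulmxA -colE colB scalemxAr.
by rewrite colB ipZl ipZr mulrA -expr2 sqr_sqrtr.
Qed.

Let quadB w : ip w (B *m B^T *m w) = \sum_k c k * ip (col k A) w ^+ 2.
Proof.
rewrite -mulmxA ip_mulr ipE; apply: eq_bigr => k _.
by rewrite -ip_col colB ipZl -expr2 exprMn sqr_sqrtr.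
Qed.

Lemma rescaled_posdef : sym_posdef rescaled.
Proof.
have [ST _] := pS; apply: posdefI => [|v v0].
  by rewrite SE linearZ /= linearD /= trmx_mul trmxK ST.
rewrite SE -scalemxAl ipZr mulr_gt0 ?invr_gt0 // mulmxDl ipDr ltr_pwDl //.
  exact: posdef_gt0.
by rewrite quadB; apply: sumr_ge0 => k _; rewrite mulr_ge0 // sqr_ge0.
Qed.

Let nu2 k : normQ Q (col k A) ^+ 2 = ip (col k A) (Q *m col k A).
Proof. exact: normQ_sqr. Qed.

Let nu0 k : k \in T -> 0 < normQ Q (col k A).
Proof. by rewrite TE => /(normQ_gt0 pQ). Qed.

Let sumT (F : 'I_n -> R) : (forall k, k \notin T -> F k = 0) -> \sum_k F k = \sum_(k in T) F k.
Proof. by move=> F0; rewrite (bigID (mem T)) /= [X in _ + X]big1 ?addr0. Qed.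

Lemma rescaled_ell z : is_solution A0 z -> ip z z <= 1 ->
  ip (U^T *m z) (rescaled *m (U^T *m z)) <= 1.
Proof.
move=> sol z1; set w := U^T *m z.
have w1 := ell sol z1; rewrite -/w in w1.
rewrite SE -scalemxAl ipZr mulmxDl ipDr mulrC ler_pdivrMr // mul1r lerD // quadB.
have aw k : 0 <= ip (col k A) w.
  by rewrite inv_colE //; move/is_solutionP: sol; apply.
have yw0 : 0 <= ip y w.
  rewrite yE ip_suml; apply: sumr_ge0 => k kT; rewrite ipZl mulr_ge0 //.
  by rewrite divr_ge0 // sqrtr_ge0.
apply: le_trans (le_trans (ip_le_normQ pS SQ w1 yw0) ysmall).
rewrite yE ip_suml sumT => [|k kT]; last by rewrite /c xT // mul0r mul0r.
apply: ler_sum => k kT; rewrite ipZl /c -nu2.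
have nk := nu0 kT.
have le := ip_le_normQ pS SQ w1 (aw k).
rewrite -!mulrA ler_wpM2l //.
rewrite -exprVn -exprMn expr2 ler_piMl ?mulr_ge0 ?invr_ge0 ?(ltW nk) //.
by rewrite mulrC ler_pdivrMr // mul1r.
Qed.

(** The [k]-th rank-one term has trace [x_k |a_k|^2 / |a_k|_Q^2], which [purged] bounds by
    [x_k / theta^2]; the weights add up to 1. *)
Lemma rescaled_trace : \tr rescaled <= M.
Proof.
rewrite SE mxtraceZ mxtraceD [\tr (B *m _)]mxtrace_mulC mulrC ler_pdivrMr //.
rewrite mulrDr mulr1 lerD // mulrC M_def.
rewrite -[B in X in _ *m X]mul1mx trB sumT => [|k kT]; last by rewrite /c xT // !mul0r.
have -> : theta ^- 2 = \sum_(k in T) x k ord0 / theta ^+ 2 by rewrite -mulr_suml x1 mul1r.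
apply: ler_sum => k kT.
rewrite /c mul1mx -mulrA ler_wpM2l // -nu2 -norm2_sqr mulrC ler_pdivrMr ?exprn_gt0 ?nu0 //.
rewrite mulrC ler_pdivlMr ?exprn_gt0 // mulrC -exprMn ler_pXn2r ?nnegrE ?mulr_ge0 ?sqrtr_ge0 //.
  exact: pg.
exact: ltW.
Qed.

Lemma rescaled_det : 3 / 2 * \det S <= \det rescaled.
Proof.
have dS := det_posdef_gt0 pS.
have := det_posdefD B pS SQ (ltW dS).
rewrite trB sumT => [|k kT]; last by rewrite /c xT // !mul0r.
have -> : \sum_(k in T) c k * ip (col k A) (Q *m col k A) = 1.
  rewrite -x1; apply: eq_bigr => k kT; rewrite /c divfK // -nu2 expf_neq0 //.
  by rewrite gt_eqF ?nu0.
rewrite SE detZ => le.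
(* For [j = m], where [m * eps = 1 / 11], this gives [(1 + eps)^m <= 11 / 10]. The weaker bound 4/3
   leaves a factor 3/2 of the doubling. *)
have pw j : (1 + eps) ^+ j * (1 - j%:R * eps) <= 1.
  elim: j => [|j IH]; first by rewrite expr0 mul0r subr0 mulr1.
  apply: le_trans IH; rewrite exprSr -mulrA ler_wpM2l ?exprn_ge0 // ?ltW // -natr1.
  have : 0 <= j%:R :> R by [].
  by move: e0; nra.
have rm := inv_dims invS; rewrite /= in rm.
have p1 : (1 + eps) ^+ r <= 4 / 3.
  apply: (@le_trans _ _ ((1 + eps) ^+ m)).
    by rewrite ler_weXn2l // lerDl ltW.
  have := pw m; have -> : m%:R * eps = 11^-1.
    by rewrite eps_def natrM; field; rewrite pnatr_eq0 -lt0n.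
  by lra.
have P0 : 0 < (1 + eps) ^+ r by rewrite exprn_gt0.
rewrite exprVn [leRHS]mulrC ler_pdivlMr //; apply: le_trans le.
rewrite mulrAC [leRHS]mulrC ler_wpM2r ?(ltW dS) //.
by lra.
Qed.

Lemma inv_rescaled Q' : rescaled *m Q' = 1%:M -> inv N.+1 (State A T rescaled Q' U).
Proof.
move=> SQ'; split=> //=.
- by split; first exact: rescaled_posdef.
- by move=> z; exact: rescaled_ell.
- exact: rescaled_trace.
have [_ _ _ _ [rm le]] := invS; split=> //.
rewrite exprS; apply: le_trans (_ : 3 / 2 * (\det S * M ^+ (m - r)) <= _).
  by rewrite ler_wpM2l // divr_ge0.
by rewrite mulrA ler_wpM2r ?exprn_ge0 ?(ltW M_gt0) // rescaled_det.
Qed.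

End Rescale.

(** [width] speaks of the original column, the test of the projected one. They fit together because
    [U^T] does not lengthen vectors: [|a|^2 - |U^T a|^2] is the squared distance of [a] to its
    projection. *)
Lemma short_column_orth k z : k \in T ->
  normQ Q (col k A) < theta * norm2 (col k A) ->
  is_solution A0 z -> ip (col k A) (U^T *m z) = 0.
Proof.
move=> kT short sol; rewrite inv_colE //.
apply/eqP; rewrite eq_le; have /is_solutionP/(_ k) -> := sol; rewrite andbT leNgt.
apply/negP => /(width sol) [z1 [sol1 z11 le]].
have aw : ip (col k A) (U^T *m z1) <= normQ Q (col k A).
  apply: (ip_le_normQ pS SQ (ell sol1 z11)).
  by rewrite inv_colE //; move/is_solutionP: sol1; apply.
have := le_lt_trans (le_trans le _) short; rewrite -inv_colE // => /(_ aw).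
rewrite ltr_pM2l // ltNge => /negP; apply.
rewrite colAE.
set a := col k A0; rewrite -(ler_pXn2r (n := 2)) ?nnegrE ?sqrtr_ge0 // !norm2_sqr.
have := ip_ge0 (a - U *m (U^T *m a)).
rewrite ipDl !ipDr !ipNl !ipNr (ip_mull U) ip_mulr (ip_mull U) (mulmxA U^T) UU mul1mx.
by rewrite opprK addNr addr0 subr_ge0.
Qed.

Section Remove.
Variables (k : 'I_n) (W : 'M[R]_(r, r.-1)).
Hypothesis kT : k \in T.
Hypothesis short : normQ Q (col k A) < theta * norm2 (col k A).
Hypotheses (WW : W^T *m W = 1%:M) (aW : (col k A)^T *m W = 0).

Lemma removed_posdef : sym_posdef (W^T *m (S *m W)).
Proof.
apply: posdef_cong => // v Wv.
by rewrite -[v]mul1mx -WW -mulmxA Wv mulmx0.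
Qed.

Lemma inv_removed Q' : W^T *m (S *m W) *m Q' = 1%:M ->
  (0 < r)%N /\
  inv N (State (W^T *m A) [set j in T | col j (W^T *m A) != 0] (W^T *m (S *m W)) Q' (U *m W)).
Proof.
move=> SQ'.
have a0 : col k A != 0 by rewrite -TE.
have r0 : (0 < r)%N.
  by rewrite lt0n; apply: contraNneq a0 => r0; apply/eqP/colP => -[i ir]; exfalso; rewrite r0 in ir.
split=> //.
have [proj detW trW] := orth_complementP a0 WW aW SQ.
have ia0 : 0 < ip (col k A) (col k A) by rewrite ip_gt0.
have trle : ip (col k A) (S *m col k A) <= M * ip (col k A) (col k A).
  apply: le_trans (_ : \tr S * ip (col k A) (col k A) <= _); last by rewrite ler_pM2r.
  by rewrite -trW lerDr mulr_ge0 ?(ltW ia0) // mxtrace_posdef_ge0 //; exact: removed_posdef.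
split=> /=.
- split.
  + by rewrite AE trmx_mul mulmxA.
  + by rewrite trmx_mul -mulmxA (mulmxA U^T) UU mul1mx.
  + move=> j; rewrite inE TE andb_idl // => h; apply: contraNneq h => e.
    by rewrite colE -mulmxA -colE e mulmx0.
  (* Solutions survive the loss of a dimension because they are orthogonal to the removed
     direction. *)
  + move=> z sol; rewrite trmx_mul -!mulmxA -proj; first exact: imU.
    exact: short_column_orth.
- by split; first exact: removed_posdef.
- move=> z sol z1; rewrite trmx_mul -(mulmxA W^T).
  set w := U^T *m z; have := ell sol z1; rewrite -/w.
  by rewrite -!mulmxA -ip_mull -proj //; exact: short_column_orth.
- rewrite -(ler_pM2r ia0); apply: le_trans (_ : \tr S * ip (col k A) (col k A) <= _).
    by rewrite -trW lerDl; have [_ h] := posdef_psd pS; exact: h.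
  by rewrite ler_pM2r.
have [_ _ _ _ [rm le]] := invS; rewrite /= in rm le.
split; first by rewrite (leq_trans (leq_pred _)).
apply: le_trans le _.
(* The exponent of [M] grows by one, while the determinant changes by [|a|_Q^2 / |a|^2]. This ratio
   is at least [1 / M], since [|a|^4 <= |a|_Q^2 * (a^T S a) <= |a|_Q^2 * M * |a|^2]. *)
have -> : (m - r.-1 = (m - r).+1)%N by lia.
rewrite exprS mulrA ler_wpM2r ?exprn_ge0 ?(ltW M_gt0) //.
rewrite -(ler_pM2r ia0) mulrAC detW mulrAC -mulrA ler_wpM2l ?(ltW (det_posdef_gt0 pS)) //.
rewrite -(ler_pM2r ia0).
have := ip_CS (col k A) (col k A) pS SQ; rewrite expr2 => /le_trans; apply.
rewrite -[leRHS]mulrA mulrCA; apply: ler_wpM2l => //.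
by have [_ h] := posdef_psd pQ; exact: h.
Qed.

End Remove.
End State.
Hypothesis m_le_n : (m <= n)%N.
Local Notation X := (m * m * n)%N.

(** Bounds the cost terms by the single unit [X], with [m <= n] allowing a dimension as third
    factor; the cost inequalities become linear. *)
Lemma mono3 a b c : (a <= m -> b <= m -> c <= n -> a * b * c <= X)%N.
Proof. by move=> am bm cn; rewrite !leq_mul. Qed.

Lemma spec_rescale N st x y : inv N st -> purged st ->
  convex_comb (st_A st) (st_T st) (st_Q st) x y -> normQ (st_Q st) y <= eps ->
  spec (14 * X) (rescale cst eps st x) (fun st' => inv N.+1 st' /\ st_r st' = st_r st).
Proof.
case: st y => r A T S Q U y iS pg cc ysmall t; rewrite /rescale.
have rm : (r <= m)%N := inv_dims iS.
have [x0 xT x1 _] := cc.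
have [_ [pS SQ] _ _ _] := iS; rewrite /= in pS SQ cc x0 xT x1 ysmall.
have pQ := posdef_inv pS SQ.
have TE j : (j \in T) = (col j A != 0) by case: iS => -[_ _ h _] _ _ _ _; exact: h.
have sT : (size (enum T) <= n)%N by rewrite -cardE -[X in (_ <= X)%N]card_ord max_card.
apply: (wp_bind_spec (spec_mulM _ _)) => _ t1 -> le1.
apply: (wp_bind_spec (spec_tabulate_fun
  (F := fun k => x k ord0 / ip (col k A) (Q *m col k A)) (c := 2 * r + 1) _ _)) => [k|c t2 Hc le2].
  rewrite mem_enum TE => k0; apply: spec_bind (spec_dotM _ _) _ => _ ->.
  have -> : ip (col k A) (col k (Q *m A)) = ip (col k A) (Q *m col k A) by rewrite !colE mulmxA.
  by apply: spec_div; rewrite gt_eqF // posdef_gt0.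
have {}le2 : (t2 <= t1 + (2 * r + 1) * n)%N by apply: leq_trans le2 _; rewrite leq_add2l leq_mul2l sT orbT.
apply: (wp_bind_spec (spec_add _ _)) => _ t3 -> le3.
have e1 : cst 1 + eps != 0 by rewrite gt_eqF // addr_gt0 // eps_gt0.
apply: (wp_bind_spec (c := (3 * n + 2) * (r * r)) (P := eq^~ (rescaled A S Q x))) => [|_ t4 -> le4].
  apply: spec_weaken (spec_build_mx (c := 3 * size (enum T) + 2)
    (F := fun i j => (S i j + \sum_(k <- enum T)
       x k ord0 / ip (col k A) (Q *m col k A) * A i k * A j k) / (cst 1 + eps)) _) _ _.
  - move=> i j.
    apply: (spec_bind (c' := 2) (spec_sumM (c := 2) (F := fun k => x k ord0 / ip (col k A) (Q *m col k A) * A i k * A j k) _)) => [k kT|_ ->].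
      rewrite Hc //; apply: (@spec_bind _ 1 1 _ _ _ _ _ _ (spec_mul _ _)) => _ ->.
      exact: spec_mul.
    apply: (@spec_bind _ 1 1 _ _ _ _ _ _ (spec_add _ _)) => _ ->; exact: spec_div.
  - move=> _ ->; apply/matrixP => i j; rewrite !mxE mulrC; congr (_ * (_ + _)).
    rewrite big_enum [RHS](bigID (mem T)) /= [X in _ = _ + X]big1 ?addr0 // => k kT.
    by rewrite xT // !mul0r.
  - by rewrite leq_mul2r leq_add2r leq_mul2l sT !orbT.
have pS' := rescaled_posdef iS cc.
apply: (wp_bind_spec (spec_inverse pS')) => Q' t5 SQ' le5.
split; first by split; [exact: (inv_rescaled iS pg cc ysmall SQ') |].
have := mono3 rm rm (leqnn n); have := mono3 rm m_gt0 (leqnn n).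
have := mono3 m_gt0 m_gt0 (leqnn n); have := mono3 rm rm (leq_trans m_gt0 m_le_n).
have := mono3 rm rm (leq_trans rm m_le_n); have := mono3 m_gt0 m_gt0 (leq_trans m_gt0 m_le_n).
by clear -le1 le2 le3 le4 le5; lia.
Qed.

Lemma spec_remove N st k : inv N st -> k \in st_T st ->
  normQ (st_Q st) (col k (st_A st)) < theta * norm2 (col k (st_A st)) ->
  spec (29 * X) (remove cst (@any_basis R) st k)
    (fun st' => inv N st' /\ (st_r st').+1 = st_r st).
Proof.
case: st => r A T S Q U iS /= kT short t; rewrite /remove.
have rm : (r <= m)%N := inv_dims iS.
have a0 : col k A != 0 by case: iS => -[_ _ h _] _ _ _ _; rewrite -h.
apply: (wp_bind_spec (spec_any_basis a0)) => W t1 [WW aW] le1.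
apply: (wp_bind_spec (spec_mulM _ _)) => _ t2 -> le2.
apply: (wp_bind_spec (spec_nonzero_cols _ _)) => _ t3 -> le3.
apply: (wp_bind_spec (spec_mulM _ _)) => _ t4 -> le4.
apply: (wp_bind_spec (spec_mulM _ _)) => _ t5 -> le5.
apply: (wp_bind_spec (spec_mulM _ _)) => _ t6 -> le6.
have pS' := removed_posdef iS WW.
apply: (wp_bind_spec (spec_inverse pS')) => Q' t7 SQ' le7.
have [r0 iS'] := inv_removed iS kT short WW aW SQ'.
split; first by split; [exact: iS' | rewrite /= prednK].
have qm : (r.-1 <= m)%N := leq_trans (leq_pred r) rm.
move: le1 le2 le3 le4 le5 le6 le7; clear -rm qm m_gt0 m_le_n.
move: r.-1 qm => q qm.
have n1 := leq_trans m_gt0 m_le_n.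
have := mono3 rm rm n1; have := mono3 rm m_gt0 n1; have := mono3 m_gt0 m_gt0 n1.
have := mono3 rm qm (leqnn n); have := mono3 qm m_gt0 (leqnn n).
have := mono3 m_gt0 m_gt0 (leqnn n); have := mono3 rm rm (leq_trans qm m_le_n).
have := mono3 qm qm (leq_trans rm m_le_n).
have := mono3 rm (leqnn m) (leq_trans qm m_le_n).
have := mono3 qm qm (leq_trans qm m_le_n).
by lia.
Qed.

(** Amortisation: a test and a removal cost at most [40 * X], paid for by the drop of the dimension;
    the [+ 1] pays for the last test, which finds no short column. The bound involves the resulting
    dimension, so it does not fit [spec]. *)
Lemma wp_remove_loop N st t : inv N st ->
  wp (remove_loop cst (@any_basis R) theta st)
    (fun st' t' => [/\ inv N st', purged st' &
       (t' + 40 * X * st_r st' <= t + 40 * X * (st_r st).+1)%N]) t.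
Proof.
move=> iS; rewrite /remove_loop.
pose Inv k (st1 : state R m n) t1 :=
  [/\ inv N st1, st_r st1 = k & (t1 + 40 * X * k <= t + 40 * X * st_r st)%N].
apply: (wp_iter (Inv := Inv) (k := st_r st)); last by split.
clear iS; move=> k [r A T S Q U] t1 [iS rk le1]; rewrite /= in rk le1.
have rm : (r <= m)%N := inv_dims iS.
have [_ [pS SQ] _ _ _] := iS; rewrite /= in pS SQ.
have pQ := posdef_inv pS SQ.
have TE j : (j \in T) = (col j A != 0) by case: iS => -[_ _ h _] _ _ _ _; exact: h.
have sT : (size (enum T) <= n)%N by rewrite -cardE -[X in (_ <= X)%N]card_ord max_card.
apply: (wp_bind_spec (spec_mulM _ _)) => _ t2 -> le2.
apply: (wp_bind_spec (spec_tabulate_fun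
  (F := fun i => normQ Q (col i A) < theta * norm2 (col i A)) (c := 4 * r + 4) _ _)) => [i|small t3 Hsmall le3].
  rewrite mem_enum TE => i0.
  have n0 : 0 < norm2 (col i A) by rewrite norm2E sqrtr_gt0 ip_gt0.
  have -> : (4 * r + 4 = 2 * r + (1 + (2 * r + (1 + (1 + 1)))))%N by clear; lia.
  apply: spec_bind (spec_dotM _ _) _ => _ ->.
  have -> : ip (col i A) (col i (Q *m A)) = ip (col i A) (Q *m col i A) by rewrite !colE mulmxA.
  apply: spec_bind (spec_sqrt _) _ => [|_ ->]; first by have [_ h] := posdef_psd pQ; exact: h.
  apply: spec_bind (spec_dotM _ _) _ => _ ->.
  apply: spec_bind (spec_sqrt (ip_ge0 _)) _ => _ ->.
  rewrite -normQE -norm2E.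
  apply: spec_bind (spec_div _ _) _ => [|_ ->]; first by rewrite gt_eqF.
  by rewrite -ltr_pdivrMr //; exact: spec_less.
have {}le3 : (t3 <= t2 + (4 * r + 4) * n)%N by apply: leq_trans le3 _; rewrite leq_add2l leq_mul2l sT orbT.
have {}Hsmall i : i \in T -> small i = (normQ Q (col i A) < theta * norm2 (col i A)).
  by move=> iT; rewrite Hsmall ?mem_enum.
have {}le2 : (t2 <= t1 + 2 * r * (r * n))%N := le2.
have le23 : (t3 <= t1 + 10 * X)%N.
  have := mono3 rm rm (leqnn n); have := mono3 rm m_gt0 (leqnn n).
  have := mono3 m_gt0 m_gt0 (leqnn n).
  by clear -le2 le3; lia.
have [ex|nex] := boolP [exists i in T, small i]; last first.
  split=> //.
    move=> j jT; rewrite leNgt -Hsmall //; apply: contraNN nex => sj.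
    by apply/existsP; exists j; apply/andP.
  by move: le1; rewrite -rk /= mulnS; clear -le23; move: (40 * X * r)%N (40 * X * st_r st)%N => *; lia.
have exk : exists j, (j \in T) && small j by case/existsP: ex => j; exists j.
apply: (wp_choose exk) => j /andP [jT]; rewrite Hsmall // => short.
apply: (wp_bind_spec (spec_remove iS jT short)) => st' t4 [iS' r'] le4.
have {}r' : (st_r st').+1 = r := r'.
exists (st_r st'); first by rewrite -rk -r'.
split=> //; move: le1; rewrite -rk -r' mulnS; clear -le23 le4.
by move: (40 * X * st_r st')%N (40 * X * st_r st)%N => *; lia.
Qed.

Variables (solve : solver R) (cs ct K : nat).
Hypothesis solveP : forall r (A : 'M[R]_(r, n)) (T : {set 'I_n}) (Q : 'M[R]_r), (r <= m)%N ->
  T != finset.set0 -> (forall i, i \in T -> col i A != 0) -> sym_posdef Q ->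
  spec cs (solve A T Q eps) (solver_post A T Q eps).
Hypothesis thetaP : spec ct (compute_theta cst A0) (eq^~ theta).
Hypothesis count : forall N, (3 / 2) ^+ N <= M ^+ m -> (N <= K)%N.

(** Only the solver call, the rescaling and the last test of the removal loop are charged to each
    rescaling; all removals together account for [40 * X * m]. *)
Lemma spec_msia :
  spec (ct + 4 * X + K.+1 * (cs + 80 * X) + 40 * X * m)
    (msia cst (@any_basis R) solve A0) (max_support_solution A0).
Proof.
move=> t; rewrite /msia.
have m110 : cst (11 * m) != 0 by rewrite /real_cst pnatr_eq0 muln_eq0 /= -lt0n.
apply: (wp_bind_spec (spec_div _ m110)) => _ t1 -> le1.
rewrite (_ : cst 1 / cst (11 * m) = eps); last by rewrite eps_def /real_cst div1r.
apply: (wp_bind_spec thetaP) => _ t2 -> le2.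
apply: (wp_bind_spec (spec_nonzero_cols _ _)) => _ t3 -> le3.
rewrite id_mxE.
rewrite (_ : [set j in [set: 'I_n] | col j A0 != 0] = [set j | col j A0 != 0]); last first.
  by apply/setP => j; rewrite !inE.
pose Inv k (st : state R m n) t' := exists N, [/\ (k + N = K)%N, inv N st, purged st &
  (t' + 40 * X * st_r st <= t3 + N * (cs + 80 * X) + 40 * X * m)%N].
have X1 : (0 < X)%N by rewrite !muln_gt0 m_gt0 (leq_trans m_gt0).
have le03 : (t3 <= t + ct + 4 * X)%N.
  have := mono3 (leqnn m) m_gt0 (leqnn n); have := mono3 m_gt0 m_gt0 (leqnn n).
  by clear -X1 le1 le2 le3; lia.
apply: (wp_iter (Inv := Inv) (k := K)); last first.
  exists 0%N; rewrite addn0; split=> //; [exact: inv_init | exact: purged_init |].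
  by rewrite mul0n addn0.
clear le1 le2 le3; move=> k [r A T S Q U] t4 [N [kN iS pg le4]].
have rm : (r <= m)%N := inv_dims iS.
rewrite [st_T _]/= [st_A _]/= [st_Q _]/= [st_U _]/= [st_r _]/= in le4 *.
have NK : (N * (cs + 80 * X) <= K * (cs + 80 * X))%N by rewrite leq_mul2r -kN leq_addl orbT.
have fin t' : (t' <= t4 + cs + 40 * X ->
    t' <= t + (ct + 4 * X + K.+1 * (cs + 80 * X) + 40 * X * m))%N.
  rewrite [(K.+1 * _)%N]mulSn; clear -NK le4 le03.
  by move: (40 * X * r)%N (40 * X * m)%N (N * _)%N (K * _)%N NK le4 => *; lia.
case: ifP => [/eqP T0|/negbT Tn0].
  split; last by apply: fin; clear; lia.
  rewrite (_ : zero_mx cst m 1 = 0); last by apply/matrixP => i j; rewrite !mxE.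
  exact: inv_max_support0 iS T0.
have [[_ _ TE _] [pS SQ] _ _ _] := iS; rewrite /= in TE pS SQ.
have pQ := posdef_inv pS SQ.
have sT : (size (enum T) <= n)%N by rewrite -cardE -[X in (_ <= X)%N]card_ord max_card.
have A0' i : i \in T -> col i A != 0 by rewrite TE.
apply: (wp_bind_spec (solveP rm Tn0 A0' pQ)) => -[x y] t5 [cc alt] le5.
rewrite /= in cc alt.
apply: (wp_bind_spec (spec_mulM _ _)) => _ t6 -> le6.
apply: (wp_bind_spec (spec_mulM _ _)) => _ t7 -> le7.
apply: (wp_bind_spec (spec_tabulate_fun (F := fun i => 0 < (A^T *m (Q *m y)) i ord0) (c := 1) _ _)) => [i _|pos t8 Hpos le8].
  exact: spec_less.
have {}Hpos j : j \in T -> pos j = (0 < ip (col j A) (Q *m y)).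
  by move=> jT; rewrite Hpos ?mem_enum // ip_col.
have {}le8 : (t8 <= t7 + n)%N by apply: leq_trans le8 _; rewrite mul1n leq_add2l sT.
have le58 : (t8 <= t4 + cs + 5 * X)%N.
  have := mono3 rm rm (leq_trans m_gt0 m_le_n); have := mono3 rm m_gt0 (leqnn n).
  have := mono3 m_gt0 m_gt0 (leqnn n).
  by clear -le5 le6 le7 le8; lia.
case: ifP => [/forallP allp|/negbT nallp].
  apply: (wp_bind_spec (spec_mulM _ _)) => _ t9 -> le9.
  split.
    apply: (inv_max_support iS) => j jT; rewrite -Hpos //.
    by have := allp j; rewrite jT.
  apply: fin; have := mono3 rm (leqnn m) (leq_trans m_gt0 m_le_n).
  by clear -le9 le58; lia.
have ysmall : normQ Q y <= eps.
  case: alt => // ypos; case/negP: nallp; apply/forallP => j; apply/implyP => jT.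
  by rewrite Hpos // ip_col mulmxA ypos.
apply: (wp_bind_spec (spec_rescale iS pg cc ysmall)) => st1 t9 [iS1 r1] le9.
apply: (wp_bind (@wp_remove_loop _ _ t9 iS1)) => st2 t10 [iS2 pg2 le10].
(* Termination: the new state satisfies the invariant with [N + 1] rescalings, so [N + 1 <= K] and
   the variant [K - N] was positive. *)
have NK1 := count (inv_count iS2).
exists k.-1; first by clear -kN NK1; lia.
exists N.+1; split=> //; first by clear -kN NK1; lia.
have E1 := mulnS (40 * X)%N r; have E2 := mulSn N (cs + 80 * X)%N.
move: le10; rewrite r1 [st_r _]/= E1 E2; clear -le4 le9 le58.
move: (40 * X * r)%N (40 * X * m)%N (N * (cs + 80 * X))%N (40 * X * st_r st2)%N le4 => *.
by lia.
Qed.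

End Invariant.

(** * Operation counts *)

Section Complexity.
Variable R : realType.
Local Notation cst := (@real_cst R).

Lemma DeltaA_ge1 m n (A : 'M[R]_(m, n)) : 1 <= DeltaA A.
Proof. by have := DeltaA_ge (@indep0 _ _ _ A); rewrite big_set0. Qed.

(** Two factors 3/2 exceed 2, and one further factor makes the contradiction strict. *)
Lemma exp_three_halves (N P : nat) (x : R) :
  (3 / 2) ^+ N <= x -> x <= (2 ^ P)%:R -> (N <= 2 * P)%N.
Proof.
move=> Nx xP; rewrite leqNgt; apply/negP => lt.
have := le_trans Nx xP; rewrite leNgt => /negP; apply.
apply: (@lt_le_trans _ _ ((3 / 2) ^+ (2 * P).+1)); last by rewrite ler_weXn2l //; lra.
rewrite exprS exprM natrX.
have h : 2%:R ^+ P <= ((3 / 2) ^+ 2) ^+ P :> R by rewrite lerXn2r ?nnegrE //; lra.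
have : 0 < 2%:R ^+ P :> R by rewrite exprn_gt0.
by move: h; lra.
Qed.

Section Matrix.
Variables (m n : nat) (A : 'M[int]_(m, n)).
Hypotheses (m_gt0 : (0 < m)%N) (rkA : \rank (int_mx R A) = m).
Local Notation L := (encoding_length A).
Local Notation X := (m * m * n)%N.

Lemma rank_m_le_n : (m <= n)%N.
Proof. by rewrite -{1}rkA rank_leq_col. Qed.

Lemma m_le_L : (m <= L)%N.
Proof.
apply: leq_trans (encoding_length_ge A); apply: leq_pmulr.
exact: leq_trans m_gt0 rank_m_le_n.
Qed.

Let theta := thetaA (int_mx R A).
Let M : R := (11 * m)%:R * theta ^- 2.

Lemma theta_bounds : 0 < theta /\ theta <= 1.
Proof.
have D1 := DeltaA_ge1 (int_mx R A).
have x1 : 1 <= m%:R ^+ 2 * DeltaA (int_mx R A) ^+ 2.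
  have m1 : 1 <= m%:R :> R by rewrite ler1n.
  by rewrite -exprMn exprn_ege1 // mulr_ege1.
split; first by rewrite invr_gt0 (lt_le_trans ltr01).
by rewrite invf_le1 // (lt_le_trans ltr01).
Qed.

Lemma M_bits : M <= (2 ^ (13 * L))%:R.
Proof.
have D1 := DeltaA_ge1 (int_mx R A); have D2 := DeltaA_bits R A.
have mL := m_le_L; have L1 := leq_trans m_gt0 mL.
have -> : M = (11 * m)%:R * (m%:R ^+ 4 * DeltaA (int_mx R A) ^+ 4).
  by rewrite /M /theta /thetaA exprVn invrK; ring.
apply: (@le_trans _ _ ((11 * m)%:R * (m%:R ^+ 4 * (2 ^ L)%:R ^+ 4))).
  rewrite ler_wpM2l // ler_wpM2l ?exprn_ge0 //.
  by rewrite lerXn2r ?nnegrE // (le_trans ler01).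
rewrite -!natrX -!natrM ler_nat.
have m2 : (m <= 2 ^ L)%N by apply: leq_trans mL _; apply: ltnW; exact: ltn_expl.
have e11 : (11 <= 2 ^ (4 * L))%N.
  by apply: (@leq_trans (2 ^ 4)%N) => //; rewrite leq_exp2l //; lia.
(* The exponents bound, in this order, 11, [m], [m^4] and [Delta^4]. *)
have -> : (13 * L = 4 * L + (L + (L * 4 + L * 4)))%N by lia.
rewrite (expnD 2 (4 * L)) (expnD 2 L) (expnD 2 (L * 4)) -mulnA; apply: leq_mul => //.
apply: leq_mul => //.
by rewrite !expnM; apply: leq_mul => //; rewrite leq_exp2r.
Qed.

Lemma iteration_bound N : (3 / 2) ^+ N <= M ^+ m -> (N <= 26 * L * m)%N.
Proof.
have M0 : 0 <= M.
  by have [t0 _] := theta_bounds; rewrite mulr_ge0 // invr_ge0 exprn_ge0 // ltW.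
move=> h; have := @exp_three_halves N (13 * L * m) _ h.
have -> : (2 * (13 * L * m) = 26 * L * m)%N by lia.
apply; rewrite expnM natrX lerXn2r ?nnegrE //; exact: M_bits.
Qed.

Lemma spec_algorithm (solve : solver R) cs :
  (forall r (B : 'M[R]_(r, n)) (T : {set 'I_n}) (Q : 'M[R]_r), (r <= m)%N ->
    T != finset.set0 -> (forall i, i \in T -> col i B != 0) -> sym_posdef Q ->
    spec cs (solve r n B T Q (11 * m)%:R^-1) (solver_post B T Q (11 * m)%:R^-1)) ->
  spec (59 * (m * X) * L + 27 * L * m * (cs + 80 * X))
    (max_support_image_algorithm solve A) (max_support_solution (int_mx R A)).
Proof.
move=> solveP; have [t0 t1] := theta_bounds.
have mn := rank_m_le_n; have n0 : (0 < n)%N := leq_trans m_gt0 mn.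
have L0 : (0 < L)%N := leq_trans m_gt0 m_le_L.
have thP : spec (15 * X) (compute_theta cst (int_mx R A)) (eq^~ theta).
  apply: spec_weaken (spec_compute_theta (@int_col_ge1 R _ _ A) m_gt0) _ _ => [v [] //|].
  have := mono3 (leqnn m) m_gt0 (leqnn n); have := mono3 m_gt0 m_gt0 (leqnn n).
  have := mono3 m_gt0 m_gt0 n0; have := mono3 (leqnn m) m_gt0 n0.
  by clear; lia.
have eM : (11 * m)%:R^-1 * M = theta ^- 2.
  by rewrite /M mulKf // pnatr_eq0 muln_eq0 /= -lt0n.
have w k y0 := @width R m n A rkA k y0 m_gt0 (DeltaA_ge1 _).
apply: spec_weaken (spec_msia m_gt0 t0 t1 erefl eM w mn solveP thP iteration_bound) _ _ => //.
(* Here 59 = 15 + 4 + 40 collects computing [theta], the initial steps and all removals; 27 is 26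
   plus one for the final iteration. *)
rewrite -[(59 * _ * _)%N]mulnA.
have h1 : (X <= m * X * L)%N by rewrite -{1}[X]mul1n -{1}[(1 * _)%N]muln1 !leq_mul.
have h2 : (X * m <= m * X * L)%N by rewrite [(X * m)%N]mulnC leq_pmulr.
have h3 : ((26 * L * m).+1 * (cs + 80 * X) <= 27 * L * m * (cs + 80 * X))%N.
  rewrite leq_mul2r; apply/orP; right.
  have : (1 <= L * m)%N by rewrite muln_gt0 L0.
  by clear; lia.
move: h3; rewrite -[(40 * X * m)%N]mulnA.
by move: (_ * (cs + 80 * X))%N (27 * L * m * _)%N (X * m)%N (m * X * L)%N h1 h2 => *; lia.
Qed.

Lemma spec_algorithm_vonNeumann :
  spec (72 * 1000 * (m * m * (n * n) * L))
    (max_support_image_algorithm (vonNeumann cst) A) (max_support_solution (int_mx R A)).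
Proof.
have mn := rank_m_le_n; have n0 : (0 < n)%N := leq_trans m_gt0 mn.
have L0 : (0 < L)%N := leq_trans m_gt0 m_le_L.
have e0 : 0 < (11 * m)%:R^-1 :> R by rewrite invr_gt0 ltr0n muln_gt0.
(* With 121 m^2 steps, 2569 = 7 + 21 * 122: setup costs 7 units [m * n^2], and each step contributes
   18 + 3. Then 59 + 27 * (2569 + 80) is below 72000. *)
apply: spec_weaken (spec_algorithm (cs := 2569 * (m * (n * n))) _) _ _ => //.
  move=> r B T Q rm T0 B0 pQ.
  apply: spec_weaken (spec_vonNeumann (N := 121 * (m * m)) T0 B0 pQ e0 _) _ _ => //.
    have -> : (121 * (m * m))%:R = (11 * m)%:R ^+ 2 :> R by rewrite -natrX; congr (_%:R); lia.
    by rewrite -exprMn mulfV ?expr1n // pnatr_eq0 muln_eq0 /= -lt0n.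
  have rrn : (r * (r * n) <= m * (n * n))%N by rewrite !leq_mul // (leq_trans rm).
  have rnn : (r * (n * n) <= m * (n * n))%N by rewrite leq_mul.
  have mmn : (m * m * n <= m * (n * n))%N by rewrite -mulnA !leq_mul.
  have mmr : (m * m * r <= m * (n * n))%N by rewrite -mulnA !leq_mul // (leq_trans rm).
  have nn : (n <= m * (n * n))%N by rewrite -{1}[n]mul1n !leq_mul // leq_pmulr.
  have rn := leq_trans rm mn.
  move: rrn rnn mmn mmr nn rn; clear => *.
  by rewrite mulSn mulnDr; lia.
have h1 : (m * X <= m * (m * (n * n)))%N by rewrite leq_mul // -mulnA !leq_mul.
have h2 : (X <= m * (n * n))%N by rewrite -mulnA !leq_mul.
have -> : (m * m * (n * n) = m * (m * (n * n)))%N by rewrite !mulnA.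
apply: (@leq_trans (59 * (m * (m * (n * n))) * L + 27 * L * m * (2569 * (m * (n * n)) + 80 * (m * (n * n))))%N).
  by apply: leq_add; [rewrite leq_mul // leq_mul | rewrite leq_mul // leq_add2l leq_mul].
by move: (m * (n * n))%N => Y; clear; lia.
Qed.

End Matrix.

Lemma log_ge2_gt0 n : 0 < log_ge2 R n.
Proof. by rewrite /log_ge2 ln_gt0 // (ltr_nat _ 1) leq_max orbT. Qed.

Lemma log_ge2_le k n : (k <= n)%N -> log_ge2 R k <= log_ge2 R n.
Proof.
move=> kn; rewrite /log_ge2 ler_ln ?posrE ?ltr0n ?leq_max ?orbT // ler_nat.
by rewrite geq_max !leq_max kn leqnn !orbT.
Qed.

(** Counters are natural numbers, so a real bound on their difference may be truncated. No sign of
    [K] is known: it enters the first term squared and the second through its absolute value. *)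
Lemma solver_guarantee_spec (solve : solver R) (K : R) (m r n : nat)
    (A : 'M[R]_(r, n)) (T : {set 'I_n}) (Q : 'M[R]_r) (eps : R) :
  solver_guarantee solve K -> (r <= m)%N ->
  T != finset.set0 -> (forall i, i \in T -> col i A != 0) -> sym_posdef Q -> 0 < eps ->
  spec (Num.trunc (K ^+ 2 * (Num.sqrt (log_ge2 R n) / eps) * (m%:R * n%:R) +
                   `|K| * (m%:R ^+ 2 * n%:R)))
    (solve r n A T Q eps) (solver_post A T Q eps).
Proof.
move=> sg rm T0 A0 pQ e0 t.
set B := (X in Num.trunc X).
have Tn : (#|T| <= n)%N by rewrite -[X in (_ <= X)%N]card_ord max_card.
have rT0 : 0 <= r%:R * #|T|%:R :> R by rewrite mulr_ge0.
have rT : r%:R * #|T|%:R <= m%:R * n%:R :> R by rewrite ler_pM // ler_nat.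
have B0 : 0 <= B.
  by rewrite /B addr_ge0 // mulr_ge0 // mulr_ge0 ?sqr_ge0 // divr_ge0 ?sqrtr_ge0 // ltW.
apply: wp_mono (sg r n A T Q eps T0 A0 pQ e0 t) => -[x y] t' [[x0 xT x1 yE] alt le].
split; first by split.
have [tt'|/ltnW tt'] := leqP t' t; first by rewrite (leq_trans tt') // leq_addr.
rewrite -leq_subLR truncn_ge_nat // natrB // lerBlDl; apply: le_trans le _.
rewrite -addrA lerD2l; apply: lerD.
  have -> : K * (Num.sqrt (log_ge2 R #|T|) / eps) * (K * (r%:R * #|T|%:R)) =
    K ^+ 2 * (Num.sqrt (log_ge2 R #|T|) / eps) * (r%:R * #|T|%:R) by ring.
  apply: ler_pM => //.
    by rewrite mulr_ge0 ?sqr_ge0 // divr_ge0 ?sqrtr_ge0 // ltW.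
  rewrite ler_wpM2l ?sqr_ge0 // ler_wpM2r ?invr_ge0 ?(ltW e0) //.
  exact/ler_wsqrtr/log_ge2_le.
apply: (@le_trans _ _ (`|K| * (r%:R ^+ 2 * #|T|%:R))).
  by rewrite ler_wpM2r ?ler_norm // mulr_ge0 ?sqr_ge0.
rewrite ler_wpM2l // ler_pM ?sqr_ge0 //; last by rewrite ler_nat.
by rewrite lerXn2r ?nnegrE // ler_nat.
Qed.

End Complexity.

Theorem theoremA6 (R : realType) :
  [/\ (* the first step of the algorithm computes theta_A *)
      forall (m n : nat) (A : 'M[int]_(m, n)),
        (0 < m)%N -> \rank (int_mx R A) = m ->
        wp (compute_theta (@real_cst R) (int_mx R A))
          (fun theta _ => theta = thetaA (int_mx R A)) 0,
      exists C : R,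
      forall (m n : nat) (A : 'M[int]_(m, n)),
        (0 < m)%N -> \rank (int_mx R A) = m ->
        wp (max_support_image_algorithm (vonNeumann (@real_cst R)) A)
          (fun y t => max_support_solution (int_mx R A) y /\
             t%:R <= C * (m%:R ^+ 2 * n%:R ^+ 2 * (encoding_length A)%:R)) 0
    & forall solve : solver R,
        (exists K : R, solver_guarantee solve K) ->
      exists C : R,
      forall (m n : nat) (A : 'M[int]_(m, n)),
        (0 < m)%N -> \rank (int_mx R A) = m ->
        wp (max_support_image_algorithm solve A)
          (fun y t => max_support_solution (int_mx R A) y /\
             t%:R <= C * (m%:R ^+ 3 * n%:R * Num.sqrt (log_ge2 R n)
                            * (encoding_length A)%:R)) 0].
Proof.
split.
- move=> m n A m0 rk.
  by apply: wp_spec (spec_compute_theta (@int_col_ge1 R _ _ A) m0) _ => v t [].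
- exists (72 * 1000)%N%:R => m n A m0 rk.
  apply: wp_spec (spec_algorithm_vonNeumann m0 rk) _ => y t ms le; split=> //.
  by rewrite -!natrX -!natrM ler_nat !expnS !expn0 !muln1.
move=> solve [K sg].
(* The least value of the logarithmic factor: the quotient [ell / lam >= 1] absorbs the cost terms
   without a logarithm. *)
pose lam : R := Num.sqrt (log_ge2 R 2).
have lam0 : 0 < lam by rewrite sqrtr_gt0 log_ge2_gt0.
(* The 11 multiplying [K^2] comes from [1 / eps = 11 m]; terms over [lam] are those that lack the
   factor [ell]. *)
exists (59%:R / lam + 27%:R * (11%:R * K ^+ 2 + `|K| / lam + 80%:R / lam)) => m n A m0 rk.
have e0 : 0 < (11 * m)%:R^-1 :> R by rewrite invr_gt0 ltr0n muln_gt0.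
have mn := rank_m_le_n rk; have n0 : (0 < n)%N := leq_trans m0 mn.
apply: wp_spec (spec_algorithm m0 rk (fun r B T Q rm T0 B0 pQ =>
  solver_guarantee_spec sg rm T0 B0 pQ e0)) _ => y t ms le; split=> //.
move: le; set cs := Num.trunc _; rewrite add0n -(ler_nat R) => le; apply: le_trans le _.
set ell := Num.sqrt (log_ge2 R n) in cs *.
have ell0 : 0 <= ell := sqrtr_ge0 _.
have ell1 : 1 <= ell / lam.
  rewrite ler_pdivlMr // mul1r; apply: ler_wsqrtr.
  by rewrite /log_ge2 ler_ln ?posrE ?ltr0n ?leq_max ?orbT // ler_nat leq_max geq_max leqnn orbT.
have csB : cs%:R <= K ^+ 2 * (ell / (11 * m)%:R^-1) * (m%:R * n%:R) + `|K| * (m%:R ^+ 2 * n%:R).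
  by rewrite truncn_le addr_ge0 // mulr_ge0 // mulr_ge0 ?sqr_ge0 // divr_ge0 // ltW.
rewrite invrK in csB.
rewrite natrD !natrM [(cs + _)%:R]natrD !natrM.
set LR : R := (encoding_length A)%:R; set mR : R := m%:R; set nR : R := n%:R.
have mR0 : 0 <= mR by []; have nR0 : 0 <= nR by []; have LR0 : 0 <= LR by [].
have p0 : 0 <= mR ^+ 3 * nR * LR by rewrite !mulr_ge0 ?exprn_ge0.
rewrite natrM in csB; rewrite -/mR -/nR in csB.
apply: (@le_trans _ _ (59%:R * (mR * (mR * mR * nR)) * LR + 27%:R * LR * mR *
  (K ^+ 2 * (ell * (11%:R * mR)) * (mR * nR) + `|K| * (mR ^+ 2 * nR) + 80%:R * (mR * mR * nR)))).
  by rewrite lerD2l ler_wpM2l ?mulr_ge0 // lerD2r.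
have -> : (59%:R / lam + 27%:R * (11%:R * K ^+ 2 + `|K| / lam + 80%:R / lam)) * (mR ^+ 3 * nR * ell * LR) =
  (mR ^+ 3 * nR * LR) * ((59%:R + 27%:R * `|K| + 27%:R * 80%:R) * (ell / lam) + 27%:R * 11%:R * K ^+ 2 * ell) by ring.
have -> : 59%:R * (mR * (mR * mR * nR)) * LR + 27%:R * LR * mR *
  (K ^+ 2 * (ell * (11%:R * mR)) * (mR * nR) + `|K| * (mR ^+ 2 * nR) + 80%:R * (mR * mR * nR)) =
  (mR ^+ 3 * nR * LR) * ((59%:R + 27%:R * `|K| + 27%:R * 80%:R) + 27%:R * 11%:R * K ^+ 2 * ell) by ring.
by rewrite ler_wpM2l // lerD2r ler_peMr // !addr_ge0 ?mulr_ge0.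
Qed.
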